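(* Let $P$ be a finite poset, $n$ a natural number, and $\mathcal{J}$ a non-empty poset ideal in $\mathrm{Hom}(P,[n])$. The simplicial complex $\Delta(\mathcal{J})$ on the vertex set $P\times[n]$ defined by the Alexander dual ideal $L(\mathcal{J})^A$ (i.e. having it as Stanley–Reisner ideal) is a piecewise linear (PL) ball of codimension $|P|$ in the simplex on the vertex set $P\times[n]$, save for the following exception: $P$ is an antichain and $\mathcal{J}=\mathrm{Hom}(P,[n])$. In this exceptional case $\Delta(\mathcal{J})$ is a PL sphere and $L(\mathcal{J})^A=L(n,P)$ is a complete intersection of $|P|$ monomials of degree $n$.
   Context: $\Bbbk$ is a field, $[n]=\{1<2<\dots<n\}$. $\mathrm{Hom}(P,[n])$ is the set of isotone (order-preserving) maps $P\to[n]$, a poset under the pointwise order $\phi\le\psi$ iff $\phi(p)\le\psi(p)$ for all $p$. A poset ideal is a down-closed subset. In the polynomial ring $\Bbbk[x_{P\times[n]}]$ with variables $x_{p,i}$, put $m_{\Gamma\phi}=\prod_{p\in P}x_{p,\phi(p)}$ for $\phi\in\mathrm{Hom}(P,[n])$; $L(\mathcal{J})$ is the ideal generated by the $m_{\Gamma\phi}$ with $\phi\in\mathcal{J}$. The Alexander dual $I^A$ of a squarefree monomial ideal $I$ is the ideal spanned by all monomials which have a non-trivial common divisor with every monomial in $I$. Thus the facets of $\Delta(\mathcal{J})$ are the complements in $P\times[n]$ of the graphs $\Gamma\phi=\{(p,\phi(p)):p\in P\}$, $\phi\in\mathcal{J}$. $L(n,P)$ (the $n$'th letterplace ideal) is the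 ideal generated by the monomials $x_{1,p_1}x_{2,p_2}\cdots x_{n,p_n}$ with $p_1\le p_2\le\dots\le p_n$ in $P$, where the variables $x_{i,p}$ indexed by $[n]\times P$ are identified with the variables $x_{p,i}$ indexed by $P\times[n]$. *)

(* Defs.v *)
From HB Require Import structures.
From mathcomp Require Import all_boot all_order all_algebra.
From mathcomp Require Import mpoly.
From mathcomp Require Import boolp classical_sets functions reals.

Set Implicit Arguments.
Unset Strict Implicit.
Unset Printing Implicit Defensive.

Import Order.TTheory GRing.Theory Num.Theory.

Local Open Scope classical_set_scope.
Local Open Scope ring_scope.

Section Posets.
Context (dP dQ : Order.disp_t) (P : finPOrderType dP) (Q : finPOrderType dQ).

Definition isotone_maps : set {ffun P -> Q} :=
  [set phi | forall p q : P, (p <= q)%O -> (phi p <= phi q)%O].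

Definition pointwise_le (phi psi : {ffun P -> Q}) : Prop :=
  forall p : P, (phi p <= psi p)%O.

Definition poset_ideal (J : set {ffun P -> Q}) : Prop :=
  J `<=` isotone_maps /\
  forall phi psi, isotone_maps psi -> pointwise_le psi phi -> J phi -> J psi.

Definition antichain : Prop := forall p q : P, (p <= q)%O -> p = q.

End Posets.

Arguments isotone_maps {dP dQ} P Q _.
Arguments antichain {dP} P.

Definition ideal_gen (A : comNzRingType) (G : set A) : set A :=
  [set f | exists s : seq (A * A),
     (forall c, c \in s -> G c.2) /\ f = \sum_(c <- s) c.1 * c.2].

(* Each term is a nonzerodivisor modulo the preceding ones, and the whole
   sequence generates a proper ideal. *)
Definition regular_sequence (A : comNzRingType) (s : seq A) : Prop :=
  (forall i, (i < size s)%N -> forall f,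
     ideal_gen [set` take i s] (f * nth 0 s i) ->
     ideal_gen [set` take i s] f) /\
  ~ ideal_gen [set` s] 1.

Section MonomialIdeals.
Context (K : fieldType) (V : finType).

Definition polyring := {mpoly K[#|{: V}|]}.

Definition var (v : V) : polyring := 'X_(enum_rank v).

Definition alexander_dual (I : set polyring) : set polyring :=
  ideal_gen [set f | exists2 m : 'X_{1..#|{: V}|}, f = 'X_[m] &
    forall m' : 'X_{1..#|{: V}|}, I 'X_[m'] ->
      exists d : 'X_{1..#|{: V}|},
        [/\ d != 0%MM, (d <= m)%MM & (d <= m')%MM]].

(* The simplicial complex whose Stanley-Reisner ideal is the squarefree
   monomial ideal I: its non-faces are the sets of vertices whose product of
   variables lies in I. *)
Definition stanley_reisner_complex (I : set polyring) : set {set V} :=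
  [set F | ~ I (\prod_(v in F) var v)].

Definition monomial_complete_intersection (c e : nat) (I : set polyring) :
    Prop :=
  exists s : seq 'X_{1..#|{: V}|},
    [/\ size s = c, (forall m, m \in s -> mdeg m = e),
        regular_sequence [seq 'X_[m] : polyring | m <- s] &
        I = ideal_gen [set` [seq 'X_[m] : polyring | m <- s]]].

End MonomialIdeals.

Section LetterplaceIdeals.
Context (K : fieldType) (d : Order.disp_t) (P : finPOrderType d) (n : nat).

Definition graph_monomial (phi : {ffun P -> 'I_n}) : polyring K (P * 'I_n)%type :=
  \prod_(p : P) var K (p, phi p).

Definition coletterplace_ideal (J : set {ffun P -> 'I_n}) :
    set (polyring K (P * 'I_n)%type) :=
  ideal_gen (graph_monomial @` J).

Definition letterplace_ideal : set (polyring K (P * 'I_n)%type) :=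
  ideal_gen [set f | exists2 c : {ffun 'I_n -> P}, isotone_maps _ _ c &
    f = \prod_(i < n) var K (c i, i)].

Definition dual_complex (J : set {ffun P -> 'I_n}) : set {set P * 'I_n} :=
  stanley_reisner_complex (alexander_dual (coletterplace_ideal J)).

End LetterplaceIdeals.

Arguments coletterplace_ideal K {d P n} J _.
Arguments letterplace_ideal K {d} P n _.
Arguments dual_complex K {d P n} J _.

Section PL.
Context (R : realType).

(* The geometric realization in R^V of a complex D on V: the points given by
   barycentric coordinates whose support is a face of D. *)
Definition realization (V : finType) (D : set {set V}) : set {ffun V -> R} :=
  [set x | [/\ forall v, 0 <= x v, \sum_v x v = 1 &
               D [set v | x v != 0]%SET]].

Definition convex_hull (V : finType) (s : seq {ffun V -> R}) :
    set {ffun V -> R} :=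
  [set x | exists l : 'I_(size s) -> R,
     [/\ forall i, 0 <= l i, \sum_i l i = 1 &
         forall v, x v = \sum_i l i * tnth (in_tuple s) i v]].

Definition segment_point (V : finType) (a : R) (x y : {ffun V -> R}) :
    {ffun V -> R} := [ffun v => (1 - a) * x v + a * y v].

Definition affine_on (V W : finType) (C : set {ffun V -> R})
    (f : {ffun V -> R} -> {ffun W -> R}) : Prop :=
  forall a x y, 0 <= a <= 1 -> C x -> C y ->
    f (segment_point a x y) = segment_point a (f x) (f y).

(* X is a finite union of convex polytopes, on each of which f is affine. *)
Definition piecewise_linear (V W : finType) (X : set {ffun V -> R})
    (f : {ffun V -> R} -> {ffun W -> R}) : Prop :=
  exists ts : seq (seq {ffun V -> R}),
    X = [set x | exists2 t, t \in ts & convex_hull t x] /\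
    forall t, t \in ts -> affine_on (convex_hull t) f.

(* A piecewise linear map is continuous, its finitely many pieces being
   compact, and the inverse of a piecewise linear bijection is piecewise linear
   on the images of the pieces; so a piecewise linear bijection is a
   homeomorphism. *)
Definition pl_homeomorphic (V W : finType) (D : set {set V}) (E : set {set W}) :
    Prop :=
  exists f : {ffun V -> R} -> {ffun W -> R},
    set_bij (realization D) (realization E) f /\
    piecewise_linear (realization D) f.

(* The index k is the dimension plus one: in both definitions the model has
   dimension k - 1. For k = 0 both models are the complex whose only face is
   the empty set, of dimension -1. *)
Definition pl_ball (k : nat) (V : finType) (D : set {set V}) : Prop :=
  pl_homeomorphic D [set: {set 'I_k}].

Definition pl_sphere (k : nat) (V : finType) (D : set {set V}) : Prop :=
  pl_homeomorphic D [set F : {set 'I_k.+1} | F != finset.setT].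

(* Codimension in the simplex on the vertex set V, of dimension #|V| - 1. *)
Definition pl_ball_of_codim (c : nat) (V : finType) (D : set {set V}) : Prop :=
  exists2 k, (k + c = #|V|)%N & pl_ball k D.

Definition pl_sphere_of_codim (c : nat) (V : finType) (D : set {set V}) :
    Prop :=
  exists2 k, (k + c = #|V|)%N & pl_sphere k D.

End PL.

(* Main.v *)
Require Import Defs.
From mathcomp Require Import all_boot all_order all_algebra lra.
From mathcomp Require Import mpoly.
From mathcomp Require Import boolp classical_sets functions reals.
Import Order.TTheory GRing.Theory Num.Theory.

(* The facets of the complex are the complements of the graphs of the maps in
   J. Let phi be a maximal element of J other than the least map. The faces of
   the facet of phi not shared with the facets of J \ phi are those containing
   S, the set of the (p, i) such that i < phi p and i >= phi q for all q < p.
   Let T be the rest of this facet. When T is nonempty, one slides the star of T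
   along itself, decreasing the coordinates on S and increasing those on T,
   until the facet of phi is absorbed into its complement; this is a PL
   homeomorphism between the complexes of J and of J \ phi. So the complex of J
   is PL homeomorphic to that of the least map, which is a simplex. T is empty
   only when P is an antichain and phi the greatest map. In this exceptional
   case the complex is a join of |P| boundaries of simplices, and inverse
   stellar subdivisions merge two such boundaries into a single one.

   PL maps are given by max-plus formulas on finitely many pieces, which makes
   composition immediate; such a formula is affine on the cells of a polyhedral
   subdivision, and a bounded polyhedron is the convex hull of finitely many
   points. *)

(** * Piecewise linear maps and convex polytopes *)

Section Polytopes.
Local Open Scope classical_set_scope.
Local Open Scope ring_scope.
Context {R : realType} {V : finType}.
Implicit Types (x y z d : {ffun V -> R}) (a b : R * {ffun V -> R}).
Implicit Types (c : seq (R * {ffun V -> R})) (t : seq {ffun V -> R}).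

Definition lin a x : R := \sum_v a.2 v * x v.
Definition aff a x : R := a.1 + lin a x.
Definition region c : set {ffun V -> R} :=
  [set x | forall a, a \in c -> 0 <= aff a x].

Lemma aff_segment a (s : R) x y :
  aff a (segment_point s x y) = (1 - s) * aff a x + s * aff a y.
Proof.
rewrite /aff /lin; under eq_bigr do rewrite ffunE mulrDr !(mulrCA (a.2 _)).
rewrite big_split -!mulr_sumr /=; lra.
Qed.

Lemma aff_shift a x (s : R) y :
  aff a [ffun v => x v + s * y v] = aff a x + s * lin a y.
Proof.
rewrite /aff /lin; under eq_bigr do rewrite ffunE mulrDr (mulrCA (a.2 _)).
by rewrite big_split -mulr_sumr /= addrA.
Qed.

Lemma lin_sub a x y : lin a [ffun v => x v - y v] = aff a x - aff a y.
Proof.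
rewrite /aff /lin; under eq_bigr do rewrite ffunE mulrBr.
by rewrite sumrB; lra.
Qed.

Lemma linN a x : lin a [ffun v => - x v] = - lin a x.
Proof. by rewrite /lin -sumrN; apply: eq_bigr => v _; rewrite ffunE mulrN. Qed.

Lemma region_cat c1 c2 x : region (c1 ++ c2) x <-> region c1 x /\ region c2 x.
Proof.
split=> [H | [H1 H2] a]; last by rewrite mem_cat => /orP[/H1|/H2].
by split=> a ac; apply: H; rewrite mem_cat ac ?orbT.
Qed.

Lemma region_cons a c x : region (a :: c) x <-> 0 <= aff a x /\ region c x.
Proof.
split=> [H | [H1 H2] b]; last by rewrite inE => /predU1P[->|/H2].
by split=> [|b bc]; apply: H; rewrite inE ?eqxx ?bc ?orbT.
Qed.

Lemma region_segment c (s : R) x y : 0 <= s <= 1 ->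
  region c x -> region c y -> region c (segment_point s x y).
Proof.
case/andP=> s0 s1 cx cy a ac; rewrite aff_segment.
by rewrite addr_ge0 // mulr_ge0 ?subr_ge0 // ?cx ?cy.
Qed.

Lemma mem_convex_hull t x : x \in t -> convex_hull t x.
Proof.
move=> xt; have ix : (index x t < size t)%N by rewrite index_mem.
pose i0 := Ordinal ix; exists (fun i => (i == i0)%:R).
split=> [i||v]; first by rewrite ler0n.
  by rewrite (bigD1 i0) //= eqxx big1 ?addr0 // => i /negPf ->.
rewrite (bigD1 i0) //= eqxx mul1r big1 ?addr0 => [|i /negPf ->]; last first.
  by rewrite mul0r.
by rewrite (tnth_nth x) /= nth_index.
Qed.

Lemma convex_hull_segment t (s : R) x y : 0 <= s <= 1 ->
  convex_hull t x -> convex_hull t y -> convex_hull t (segment_point s x y).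
Proof.
case/andP=> s0 s1 [l [l0 l1 lx]] [m [m0 m1 my]].
exists (fun i => (1 - s) * l i + s * m i); split.
- by move=> i; rewrite addr_ge0 // mulr_ge0 ?subr_ge0.
- by rewrite big_split -!mulr_sumr /= l1 m1; lra.
move=> v; rewrite ffunE lx my !mulr_sumr -big_split /=.
by apply: eq_bigr => i _; lra.
Qed.

Lemma convex_hull_region c t : (forall y, y \in t -> region c y) ->
  convex_hull t `<=` region c.
Proof.
move=> tc x [l [l0 l1 lx]] a ac.
suff -> : aff a x = \sum_i l i * aff a (tnth (in_tuple t) i).
  apply: sumr_ge0 => i _; rewrite mulr_ge0 //.
  by apply: (tc _ (mem_tnth _ (in_tuple t))).
under eq_bigr do rewrite mulrDr; rewrite big_split -mulr_suml l1 mul1r.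
congr (_ + _); rewrite /lin; under [LHS]eq_bigr do rewrite lx mulr_sumr.
rewrite exchange_big; apply: eq_bigr => i _ /=; rewrite mulr_sumr.
by apply: eq_bigr => v _; rewrite mulrCA.
Qed.

Definition tight c x : {set 'I_(size c)} :=
  [set i | aff (tnth (in_tuple c) i) x == 0]%SET.

Lemma regionP c x :
  region c x <-> forall i, 0 <= aff (tnth (in_tuple c) i) x.
Proof.
split=> [cx i|H a /(tnthP (in_tuple c))[i ->]//].
exact/cx/(mem_tnth i (in_tuple c)).
Qed.

(** Boundedness makes some constraint decrease along [d]. As in the ratio test of the simplex
    method, one moves until the first of the decreasing constraints vanishes. *)
Lemma region_ray_exit c x d :
  (forall y, region c y -> forall v, 0 <= y v <= 1) -> region c x ->
  (exists v, d v != 0) ->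
  (forall i, i \in tight c x -> lin (tnth (in_tuple c) i) d = 0) ->
  exists s : R, [/\ 0 < s, region c [ffun v => x v + s * d v] &
    tight c x \proper tight c [ffun v => x v + s * d v]]%SET.
Proof.
move=> cbnd cx [v0 dv0] dtight; pose A := tnth (in_tuple c).
have [i0 i0P] : exists i, lin (A i) d < 0.
  apply/not_existsP => H.
  have ray s : 0 <= s -> region c [ffun v => x v + s * d v].
    move=> s0; apply/regionP => i; rewrite aff_shift.
    rewrite addr_ge0 ?mulr_ge0 //; first exact: (regionP c x).1.
    by rewrite leNgt; apply/negP/H.
  (* This time moves the coordinate at [v0] by 2, hence out of the unit interval. *)
  have s0 : 0 <= 2 / `|d v0| by rewrite divr_ge0.
  have /andP[] := cbnd _ (ray _ s0) v0; rewrite ffunE.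
  have /andP[] := cbnd _ cx v0.
  have [dneg|dpos] := ltrP (d v0) 0; [rewrite ltr0_norm // | rewrite ger0_norm //].
    by rewrite invrN mulrN mulNr divfK //; lra.
  by rewrite divfK //; lra.
case: (@arg_minP _ _ _ i0 (fun i => lin (A i) d < 0)
  (fun i => aff (A i) x / - lin (A i) d) i0P) => i iP imin.
have pos_i : 0 < aff (A i) x.
  rewrite lt_neqAle (regionP c x).1 // andbT eq_sym; apply/negP => tight_i.
  by move: iP; rewrite dtight ?ltxx // inE.
exists (aff (A i) x / - lin (A i) d).
have s_gt0 : 0 < aff (A i) x / - lin (A i) d by rewrite divr_gt0 ?oppr_gt0.
split=> //; first apply/regionP => j.
  rewrite aff_shift; have [jneg|jpos] := ltrP (lin (A j) d) 0; last first.
    by apply: addr_ge0; [exact: (regionP c x).1 | exact: mulr_ge0 (ltW s_gt0) _].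
  have := imin j jneg; rewrite ler_pdivlMr ?oppr_gt0 // mulrN.
  by rewrite -subr_ge0 opprK.
apply/properP; split; first apply/fintype.subsetP => j tj.
  by move: (tj); rewrite !inE aff_shift dtight // mulr0 addr0.
exists i; last by rewrite inE gt_eqF.
rewrite inE aff_shift -/(A i) invrN mulrN mulNr divfK ?subrr //.
exact: ltr0_neq0.
Qed.

(* The vertices are the points determined by their set of tight constraints;
   any other point lies inside a segment whose ends are tight for strictly more
   constraints. *)
Lemma bounded_region_hull c :
  (forall x, region c x -> forall v, 0 <= x v <= 1) ->
  exists t, convex_hull t = region c.
Proof.
move=> cbnd.
pose Q (T : {set 'I_(size c)}) :=
  [set x | region c x /\ (T \subset tight c x)%SET].
(* One point is picked in each nonempty [Q T]. It is a vertex when [Q T] is a singleton, and a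
   harmless extra point of the region otherwise. *)
pose t := [seq xget [ffun => 0] (Q T) | T <- enum {set 'I_(size c)}
  & `[< Q T !=set0 >]].
exists t; apply/seteqP; split.
  apply: convex_hull_region => y /mapP[T]; rewrite mem_filter => /andP[+ _ ->].
  by move=> /asboolP[z Qz]; case: (xgetPex [ffun => 0] (ex_intro _ z Qz)).
move=> x; move: {2}_.+1 (ltnSn #|~: tight c x|%SET) => k.
elim: k x => // k IH x xk cx.
have [[y [Qy yx]]|H] := pselect (exists y, Q (tight c x) y /\ y <> x); last first.
  have Qx : Q (tight c x) x by [].
  apply: mem_convex_hull; apply/mapP; exists (tight c x).
    by rewrite mem_filter mem_enum andbT; apply/asboolP; exists x.
  case: xgetP => [y _ Qy|/(_ x) nQx].
    by apply: contrapT => xy; apply: H; exists y; split=> // yx; apply: xy.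
  by case: nQx.
pose d := [ffun v => y v - x v]; pose d' := [ffun v => - d v].
have dx0 : exists v, d v != 0.
  apply/not_existsP => H; apply: yx; apply/ffunP => v.
  by have /negP/negPn := H v; rewrite ffunE subr_eq0 => /eqP.
have dtight i : i \in tight c x -> lin (tnth (in_tuple c) i) d = 0.
  move=> ti; rewrite lin_sub; have := fintype.subsetP Qy.2 i ti.
  by move: ti; rewrite !inE => /eqP -> /eqP ->; rewrite subrr.
have [s1 [s1_gt0 cy1 ty1]] := region_ray_exit c x d cbnd cx dx0 dtight.
have [||s2 [s2_gt0 cy2 ty2]] := region_ray_exit c x d' cbnd cx.
- by have [v dv] := dx0; exists v; rewrite ffunE oppr_eq0.
- by move=> i ti; rewrite linN dtight ?oppr0.
set y1 := [ffun v => _] in cy1 ty1; set y2 := [ffun v => _] in cy2 ty2.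
have hull_of z : region c z -> (tight c x \proper tight c z)%SET ->
    convex_hull t z.
  move=> cz tz; apply: IH => //; apply: (leq_trans _ (ltnSE xk)).
  by apply: proper_card; rewrite properC.
(* As [y1] is [x + s1 * d] and [y2] is [x - s2 * d], this weight cancels the displacements. *)
have -> : x = segment_point (s1 / (s1 + s2)) y1 y2.
  set a := s1 / _; have aE : a * (s1 + s2) = s1.
    by rewrite divfK ?gt_eqF ?addr_gt0.
  apply/ffunP => v; rewrite !ffunE.
  by move/(congr1 ( *%R^~ (y v - x v))): aE => /=; lra.
apply: convex_hull_segment; try exact: hull_of.
by rewrite divr_ge0 ?ler_pdivrMr ?addr_gt0 ?mul1r ?lerDl ?ltW // addr_gt0.
Qed.

(** These formulas make sense on the whole space, so substituting one into another raises no
    question of domain. *)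
Inductive pl_fun : ({ffun V -> R} -> R) -> Prop :=
| pl_coord v : pl_fun (fun x => x v)
| pl_const r : pl_fun (fun=> r)
| pl_add f g : pl_fun f -> pl_fun g -> pl_fun (fun x => f x + g x)
| pl_scale r f : pl_fun f -> pl_fun (fun x => r * f x)
| pl_max f g : pl_fun f -> pl_fun g -> pl_fun (fun x => Num.max (f x) (g x)).

Lemma pl_fun_ext f g : f =1 g -> pl_fun f -> pl_fun g.
Proof. by move=> /funext ->. Qed.

Lemma pl_opp f : pl_fun f -> pl_fun (fun x => - f x).
Proof.
move=> plf; apply: (pl_fun_ext (fun x => -1 * f x)); last exact: pl_scale.
by move=> x; rewrite mulN1r.
Qed.

Lemma pl_sub f g : pl_fun f -> pl_fun g -> pl_fun (fun x => f x - g x).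
Proof. by move=> plf plg; apply/pl_add/pl_opp. Qed.

Lemma pl_min f g :
  pl_fun f -> pl_fun g -> pl_fun (fun x => Num.min (f x) (g x)).
Proof.
move=> plf plg; apply: (pl_fun_ext (fun x => - Num.max (- f x) (- g x))).
  by move=> x; rewrite -oppr_min opprK.
by apply/pl_opp/pl_max; apply: pl_opp.
Qed.

Lemma pl_big (I : Type) (op : R -> R -> R) (idx : {ffun V -> R} -> R)
    (r : seq I) (P : pred I) (F : I -> {ffun V -> R} -> R) :
  (forall f g, pl_fun f -> pl_fun g -> pl_fun (fun x => op (f x) (g x))) ->
  pl_fun idx -> (forall i, P i -> pl_fun (F i)) ->
  pl_fun (fun x => \big[op/idx x]_(i <- r | P i) F i x).
Proof.
move=> plop plidx plF; elim: r => [|i r IH].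
  by apply: pl_fun_ext plidx => x; rewrite big_nil.
have [Pi|nPi] := boolP (P i); last first.
  by apply: pl_fun_ext IH => x; rewrite big_cons (negPf nPi).
apply: pl_fun_ext (plop _ _ (plF i Pi) IH) => x.
by rewrite big_cons Pi.
Qed.

Lemma pl_sum (I : Type) (r : seq I) (P : pred I) F :
  (forall i, P i -> pl_fun (F i)) ->
  pl_fun (fun x => \sum_(i <- r | P i) F i x).
Proof. by move=> ?; apply: pl_big => //; [exact: pl_add | exact: pl_const]. Qed.

Definition cover (cs : seq (seq (R * {ffun V -> R}))) :=
  forall x, exists2 c, c \in cs & region c x.

(** The pieces of a sum are the intersections of pieces of the summands. For a maximum, each
    intersection is cut in two by the sign of the difference of the affine forms. *)
Lemma pl_fun_pieces f : pl_fun f ->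
  exists ps : seq (seq (R * {ffun V -> R}) * (R * {ffun V -> R})),
    cover [seq p.1 | p <- ps] /\
    forall p x, p \in ps -> region p.1 x -> f x = aff p.2 x.
Proof.
have triv (a : R * {ffun V -> R}) g : (forall x, g x = aff a x) ->
    exists ps : seq (seq (R * {ffun V -> R}) * (R * {ffun V -> R})),
    cover [seq p.1 | p <- ps] /\
    forall p x, p \in ps -> region p.1 x -> g x = aff p.2 x.
  move=> ga; exists [:: ([::], a)].
  split=> [x|p x]; last by rewrite inE => /eqP ->.
  by exists [::]; rewrite ?inE.
elim=> {f} [v|r|f g _ [ps [psc psf]] _ [qs [qsc qsg]]
           |r f _ [ps [psc psf]]|f g _ [ps [psc psf]] _ [qs [qsc qsg]]].
- apply: (triv (0, [ffun w => (w == v)%:R])) => x.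
  rewrite /aff /lin /= add0r (bigD1 v) //= ffunE eqxx mul1r big1 ?addr0 //.
  by move=> w /negPf wv; rewrite ffunE wv mul0r.
- apply: (triv (r, [ffun => 0])) => x; rewrite /aff /lin big1 ?addr0 // => v _.
  by rewrite ffunE mul0r.
- pose ad a b : R * {ffun V -> R} := (a.1 + b.1, [ffun v => a.2 v + b.2 v]).
  exists [seq (p.1 ++ q.1, ad p.2 q.2) | p <- ps, q <- qs].
  split=> [x|_ x /allpairsP[[p q] [pp qq ->]] /=].
    have [_ /mapP[p pp ->] px] := psc x; have [_ /mapP[q qq ->] qx] := qsc x.
    exists (p.1 ++ q.1); last exact/region_cat.
    by apply/mapP; eexists; first by apply/allpairsP; exists (p, q).
  move=> /region_cat[px qx]; rewrite (psf p) // (qsg q) // /ad /aff /lin /=.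
  under [in RHS]eq_bigr do rewrite ffunE mulrDl.
  by rewrite big_split /=; lra.
- pose sc a : R * {ffun V -> R} := (r * a.1, [ffun v => r * a.2 v]).
  exists [seq (p.1, sc p.2) | p <- ps].
  split=> [x|_ x /mapP[p pp ->] /= px].
    have [_ /mapP[p pp ->] px] := psc x; exists p.1 => //.
    by rewrite -map_comp; apply/mapP; exists p.
  rewrite (psf p) // /sc /aff /lin /= mulrDr mulr_sumr; congr (_ + _).
  by apply: eq_bigr => v _; rewrite ffunE mulrA.
pose sb a b : R * {ffun V -> R} := (a.1 - b.1, [ffun v => a.2 v - b.2 v]).
have sbE a b x : aff (sb a b) x = aff a x - aff b x.
  rewrite /aff /lin /=; under eq_bigr do rewrite ffunE mulrBl.
  by rewrite sumrB; lra.
exists ([seq (sb p.2 q.2 :: p.1 ++ q.1, p.2) | p <- ps, q <- qs] ++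
        [seq (sb q.2 p.2 :: p.1 ++ q.1, q.2) | p <- ps, q <- qs]); split=> [x|].
  have [_ /mapP[p pp ->] px] := psc x; have [_ /mapP[q qq ->] qx] := qsc x.
  have [le|le] := lerP (aff q.2 x) (aff p.2 x).
    exists (sb p.2 q.2 :: p.1 ++ q.1).
      rewrite map_cat mem_cat; apply/orP; left; apply/mapP.
      by eexists; first by apply/allpairsP; exists (p, q).
    by apply/region_cons; rewrite sbE subr_ge0; split=> //; apply/region_cat.
  exists (sb q.2 p.2 :: p.1 ++ q.1).
    rewrite map_cat mem_cat; apply/orP; right; apply/mapP.
    by eexists; first by apply/allpairsP; exists (p, q).
  by apply/region_cons; rewrite sbE subr_ge0 ltW //; split=> //; apply/region_cat.
move=> r x; rewrite mem_cat => /orP[] /allpairsP[[p q] [pp qq ->]] /=;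
  move=> /region_cons[+ /region_cat[px qx]]; rewrite sbE subr_ge0 => le.
  by rewrite (psf p) // (qsg q) // max_l.
by rewrite (psf p) // (qsg q) // max_r.
Qed.

Lemma pl_family_pieces (U : finType) (F : U -> {ffun V -> R} -> R) :
  (forall u, pl_fun (F u)) ->
  exists cs, cover cs /\ forall c u, c \in cs ->
    exists a, forall x, region c x -> F u x = aff a x.
Proof.
move=> plF.
suff [cs [csc csF]] : exists cs, cover cs /\
    forall c u, c \in cs -> u \in enum U ->
    exists a, forall x, region c x -> F u x = aff a x.
  by exists cs; split=> // c u cc; apply: csF => //; rewrite mem_enum.
elim: (enum U) => [|u us [cs [csc csF]]].
  by exists [:: [::]]; split=> // x; exists [::]; rewrite ?inE.
have [ps [psc psF]] := pl_fun_pieces _ (plF u).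
exists [seq p.1 ++ c | p <- ps, c <- cs]; split=> [x|c' w].
  have [_ /mapP[p pp ->] px] := psc x; have [c cc cx] := csc x.
  exists (p.1 ++ c); last exact/region_cat.
  by apply/allpairsP; exists (p, c).
move=> /allpairsP[[p c] /= [pp cc ->]]; rewrite inE.
move=> /predU1P[->|/(csF _ _ cc)[a aP]].
  by exists p.2 => x /region_cat[px _]; apply: psF.
by exists a => x /region_cat[_]; apply: aP.
Qed.

End Polytopes.

Section PLMaps.
Local Open Scope classical_set_scope.
Local Open Scope ring_scope.
Context {R : realType}.

Lemma pl_fun_comp {V W : finType} (f : {ffun W -> R} -> R)
    (F : {ffun V -> R} -> {ffun W -> R}) :
  pl_fun f -> (forall w, pl_fun (fun x => F x w)) -> pl_fun (fun x => f (F x)).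
Proof.
move=> plf plF; elim: plf => [w|r|g h _ IHg _ IHh|r g _ IHg|g h _ IHg _ IHh].
- exact: plF.
- exact: pl_const.
- exact: pl_add.
- exact: pl_scale.
- exact: pl_max.
Qed.

(** The sets [0 <= g i x] are the pieces. Each has its own formula [F i], and [f] is unconstrained
    outside [X]. *)
Definition pl_map {V W : finType} (X : set {ffun V -> R})
    (f : {ffun V -> R} -> {ffun W -> R}) : Prop :=
  exists (I : finType) (g : I -> {ffun V -> R} -> R)
         (F : I -> {ffun V -> R} -> {ffun W -> R}),
    [/\ forall i, pl_fun (g i), forall i w, pl_fun (fun x => F i x w),
        forall x, X x <-> exists i, 0 <= g i x &
        forall i x, 0 <= g i x -> f x = F i x].

Lemma pl_map_comp {V W U : finType} (X : set {ffun V -> R})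
    (Y : set {ffun W -> R}) (f : {ffun V -> R} -> {ffun W -> R})
    (h : {ffun W -> R} -> {ffun U -> R}) :
  (forall x, X x -> Y (f x)) -> pl_map X f -> pl_map Y h -> pl_map X (h \o f).
Proof.
move=> XY [I [g [F [plg plF Xg fF]]]] [J [k [H [plk plH Yk hH]]]].
exists (I * J)%type, (fun ij x => Num.min (g ij.1 x) (k ij.2 (F ij.1 x))),
  (fun ij x => H ij.2 (F ij.1 x)); split.
- by move=> [i j]; apply: pl_min => //=; apply: pl_fun_comp.
- by move=> [i j] u /=; exact: (pl_fun_comp (fun y => H j y u)).
- move=> x; split=> [Xx|[[i j]] /=]; last first.
    by rewrite le_min => /andP[gx _]; apply/Xg; exists i.
  have [i gi] := (Xg x).1 Xx; have [j kj] := (Yk _).1 (XY _ Xx).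
  by exists (i, j); rewrite /= le_min gi -(fF i x gi).
by move=> [i j] x /=; rewrite le_min => /andP[gi kj]; rewrite (fF i) // (hH j).
Qed.

(** Each piece is cut into cells on which [g i] and all coordinates of [F i] are affine. Adding the
    inequality [0 <= g i x] to a cell gives a polyhedron inside the bounded set [X], hence a convex
    hull. *)
Lemma pl_map_piecewise_linear {V W : finType} (X : set {ffun V -> R})
    (f : {ffun V -> R} -> {ffun W -> R}) :
  (forall x, X x -> forall v, 0 <= x v <= 1) ->
  pl_map X f -> piecewise_linear X f.
Proof.
move=> Xbnd [I [g [F [plg plF Xg fF]]]].
have step i : exists ts : seq (seq {ffun V -> R}),
    (forall x, 0 <= g i x <-> exists2 t, t \in ts & convex_hull t x) /\
    (forall t, t \in ts -> affine_on (convex_hull t) f).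
  pose G (u : option W) x := if u is Some w then F i x w else g i x.
  have [[w|]|cs [csc csG]] := pl_family_pieces _ G; [exact: plF|exact: plg|].
  have piece c : exists t, c \in cs ->
      convex_hull t = region c `&` [set x | 0 <= g i x] /\
      affine_on (convex_hull t) f.
    have [cc|] := pselect (c \in cs); last by exists [::].
    have [a aP] := csG c None cc; have gE x : region c x -> g i x = aff a x := aP x.
    have regE x : region (a :: c) x <-> region c x /\ 0 <= g i x.
      split=> [/region_cons[ax cx]|[cx gx]]; first by rewrite gE.
      by apply/region_cons; rewrite -gE.
    have [|t tE] := @bounded_region_hull R V (a :: c).
      by move=> x /regE[_ gx]; apply: Xbnd; apply/Xg; exists i.
    exists t => _; split.
      by rewrite tE; apply/seteqP; split=> x /regE.
    move=> s x y s01; rewrite tE => xc yc.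
    have zc := region_segment _ _ _ _ s01 xc yc.
    have [cx gx] := (regE _).1 xc; have [cy gy] := (regE _).1 yc.
    have [cz gz] := (regE _).1 zc.
    rewrite !(fF i) //; apply/ffunP => w; rewrite [in RHS]ffunE.
    have [b bP] := csG c (Some w) cc.
    by have /= Eb := bP; rewrite !Eb // aff_segment.
  have [h hP] := choice piece.
  exists (map h cs); split=> [x|t /mapP[c cc ->]]; last by case: (hP c cc).
  split=> [gx|[_ /mapP[c cc ->]]]; last by rewrite (hP c cc).1 => -[].
  have [c cc cx] := csc x; exists (h c); first exact: map_f.
  by rewrite (hP c cc).1.
have [h hP] := choice step.
exists (flatten [seq h i | i <- enum I]); split; last first.
  by move=> t /flatten_mapP[i _ /(hP i).2].
apply/seteqP; split=> x.
  move=> /Xg[i /(hP i).1[t ti tx]]; exists t => //.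
  by apply/flatten_mapP; exists i; rewrite ?mem_enum.
move=> [t /flatten_mapP[i _ ti] tx]; apply/Xg; exists i.
by apply/(hP i).1; exists t.
Qed.

Lemma realization_bounded {V : finType} (D : set {set V}) (x : {ffun V -> R}) :
  realization D x -> forall v, 0 <= x v <= 1.
Proof.
move=> [x0 x1 _] v; rewrite x0 -x1 (bigD1 v) //= lerDl.
by apply: sumr_ge0.
Qed.

Definition pl_iso {V W : finType} (D : set {set V}) (E : set {set W}) : Prop :=
  exists f, set_bij (realization (R:=R) D) (realization E) f /\
    pl_map (realization D) f.

Lemma pl_iso_trans {V W U : finType} (D : set {set V}) (E : set {set W})
    (G : set {set U}) : pl_iso D E -> pl_iso E G -> pl_iso D G.
Proof.
move=> [f [[f1 f2 f3] plf]] [g [[g1 g2 g3] plg]]; exists (g \o f).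
split; last by apply: pl_map_comp plf plg => x; apply: f1.
split=> [x Xx|x y Xx Xy /= Exy|z /g3[y /f3[x Xx <-] <-]].
- exact/g1/f1.
- by apply: f2 => //; apply: g2 => //; rewrite inE; apply: f1; rewrite -inE.
- by exists x.
Qed.

Lemma pl_iso_homeomorphic {V W : finType} (D : set {set V})
    (E : set {set W}) : pl_iso D E -> pl_homeomorphic R D E.
Proof.
move=> [f [fbij plf]]; exists f; split=> //.
exact: pl_map_piecewise_linear (@realization_bounded _ D) plf.
Qed.

Lemma pl_isoW {V W : finType} (D : set {set V}) (E : set {set W})
    (f : {ffun V -> R} -> {ffun W -> R}) (g : {ffun W -> R} -> {ffun V -> R}) :
  pl_map (realization D) f ->
  (forall x, realization D x -> realization E (f x) /\ g (f x) = x) ->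
  (forall y, realization E y -> realization D (g y) /\ f (g y) = y) ->
  pl_iso D E.
Proof.
move=> plf fP gP; exists f; split=> //; split.
- by move=> x /fP[].
- move=> x y; rewrite !inE => /fP[_ fx] /fP[_ fy] Efxy.
  by rewrite -fx -fy Efxy.
- by move=> y /gP[? ?]; exists (g y).
Qed.

(* Nonpositive everywhere, and zero exactly on the closed face spanned by F. *)
Definition face_gap {V : finType} (F : {set V}) (x : {ffun V -> R}) : R :=
  \big[Num.min/Num.min (\sum_v x v - 1) (1 - \sum_v x v)]_v
    Num.min (x v) (if v \in F then 0 else - x v).

(** A realization is the union of its closed faces, each cut out by its [face_gap], so one formula
    for each closed face is enough. *)
Lemma pl_map_realization {V W : finType} (D : set {set V})
    (f : {ffun V -> R} -> {ffun W -> R})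
    (H : {set V} -> {ffun V -> R} -> {ffun W -> R}) :
  (forall F G : {set V}, F \subset G -> D G -> D F) ->
  (forall F w, pl_fun (fun x => H F x w)) ->
  (forall F x, D F -> realization D x -> [set v | x v != 0]%SET \subset F ->
    f x = H F x) ->
  pl_map (realization D) f.
Proof.
move=> Ddown plH fH.
have gapP F x : 0 <= face_gap F x <->
    [/\ forall v, 0 <= x v, \sum_v x v = 1 & [set v | x v != 0]%SET \subset F].
  rewrite /face_gap; split.
    move=> ge0; have pos v : 0 <= Num.min (x v) (if v \in F then 0 else - x v).
      by apply: le_trans ge0 _; apply: bigmin_le_cond.
    have x0 v : 0 <= x v by have := pos v; rewrite le_min => /andP[].
    split=> //.
      have := le_trans ge0 (bigmin_le_id _ _ _ _).
      by rewrite le_min => /andP[]; rewrite !subr_ge0 => ? ?; apply/le_anti/andP.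
    apply/fintype.subsetP => v; rewrite inE; apply: contraNT => vF.
    rewrite eq_le x0 andbT.
    by have := pos v; rewrite le_min (negPf vF) /= oppr_ge0 => /andP[].
  move=> [x0 x1 xF]; apply: le_bigmin => [|v _]; first by rewrite x1 subrr minxx.
  rewrite le_min x0; case: ifP => vF; rewrite /= ?lexx // oppr_ge0.
  have : v \notin [set v | x v != 0]%SET.
    by apply/negP => /(fintype.subsetP xF); rewrite vF.
  by rewrite inE negbK => /eqP ->.
(* The constant -1 gives an empty piece to the sets that are not faces. *)
exists {set V}, (fun F x => if `[< D F >] then face_gap F x else -1), H; split.
- move=> F; case: asboolP => _; last exact: pl_const.
  have pls : pl_fun (fun x : {ffun V -> R} => \sum_v x v).
    by apply: pl_sum => v _; apply: pl_coord.
  apply: (pl_big _ _ (fun x => Num.min (\sum_v x v - 1) (1 - \sum_v x v)) _ _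
    (fun v x => Num.min (x v) (if v \in F then 0 else - x v))).
  - exact: pl_min.
  - by apply: pl_min; apply: pl_sub => //; apply: pl_const.
  move=> v _; apply: pl_min; first exact: pl_coord.
  case: (v \in F); first exact: pl_const.
  exact/pl_opp/pl_coord.
- by [].
- move=> x; split=> [[x0 x1 xD]|[F]].
    by exists [set v | x v != 0]%SET; rewrite asboolT //; apply/gapP.
  case: asboolP => [DF /gapP[x0 x1 xF]|_]; last by rewrite lerNr oppr0 ler10.
  by split=> //; apply: Ddown DF.
- move=> F x; case: asboolP => [DF /gapP[x0 x1 xF]|_].
    by apply: fH => //; split=> //; apply: Ddown DF.
  by rewrite lerNr oppr0 ler10.
Qed.

End PLMaps.

(** * Relabelling the vertices of a complex *)

Section Relabelling.
Local Open Scope classical_set_scope.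
Local Open Scope ring_scope.
Context {R : realType} {V : finType}.

Lemma pl_iso_relabel (A : {set V}) (D : set {set V}) (E : set {set 'I_#|A|}) :
  (forall F G : {set V}, F \subset G -> D G -> D F) ->
  (forall F, D F -> F \subset A) ->
  (forall G : {set 'I_#|A|}, E G <-> D [set enum_val i | i in G]%SET) ->
  pl_iso (R := R) D E.
Proof.
move=> Ddown DA DE.
pose f (x : {ffun V -> R}) : {ffun 'I_#|A| -> R} := [ffun i => x (enum_val i)].
pose g (y : {ffun 'I_#|A| -> R}) : {ffun V -> R} :=
  [ffun v => \sum_(i | enum_val i == v) y i].
have gval y i : g y (enum_val i) = y i.
  rewrite ffunE (eq_bigl (pred1 i)) ?big_pred1_eq // => j.
  by rewrite (inj_eq enum_val_inj).
have gout y v : v \notin A -> g y v = 0.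
  move=> vA; rewrite ffunE big_pred0 // => i; apply: contraNF vA => /eqP <-.
  exact: enum_valP.
have outA (x : {ffun V -> R}) v : realization D x -> v \notin A -> x v = 0.
  move=> [_ _ /DA/fintype.subsetP sA] vA; apply/eqP; apply: contraNT vA => xv.
  by apply: sA; rewrite inE.
have sumA (x : {ffun V -> R}) : (forall v, v \notin A -> x v = 0) ->
    \sum_i x (@enum_val _ A i) = \sum_v x v.
  move=> xA; rewrite -(big_enum_val (fun v => x v)) [RHS](bigID (mem A)) /=.
  by rewrite [X in _ = _ + X]big1 ?addr0.
have suppE (x : {ffun V -> R}) : (forall v, v \notin A -> x v = 0) ->
    [set @enum_val _ A i | i in [set i | x (enum_val i) != 0]%SET]%SET =
    [set v | x v != 0]%SET.
  move=> xA; apply/setP => v; rewrite inE; apply/imsetP/idP => [[i]|xv].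
    by rewrite inE => xi ->.
  have vA : v \in A by apply: contraNT xv => /xA ->.
  by exists (enum_rank_in vA v); rewrite ?inE enum_rankK_in.
apply: (pl_isoW D E f g).
- apply: (pl_map_realization D f (fun=> f)) => //.
  move=> F w; apply: (pl_fun_ext (fun x => x (enum_val w))); last exact: pl_coord.
  by move=> x; rewrite ffunE.
- move=> x xD; have [x0 x1 xF] := xD; have xA v := outA x v xD.
  split; last first.
    apply/ffunP => v; have [vA|vA] := boolP (v \in A); last by rewrite gout ?xA.
    by rewrite -(enum_rankK_in vA vA) gval ffunE.
  split=> [i||]; first by rewrite ffunE.
    by under eq_bigr do rewrite ffunE; rewrite sumA.
  by apply/DE; under eq_finset do rewrite ffunE; rewrite suppE.
- move=> y [y0 y1 yE].
  have fg : f (g y) = y by apply/ffunP => i; rewrite ffunE gval.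
  split=> //; split=> [v||].
  + by rewrite ffunE sumr_ge0.
  + by rewrite -sumA; [under eq_bigr do rewrite gval | exact: gout].
  + rewrite -suppE; last exact: gout.
    by under eq_finset do rewrite gval; apply/DE.
Qed.

End Relabelling.

Section SetMin.
Local Open Scope ring_scope.
Context {R : realType} {V : finType}.

Implicit Types (A : {set V}) (a v : V) (x : {ffun V -> R}).

(** The starting value [x a] does not affect the minimum once [a] lies in [A]. *)
Definition set_min (A : {set V}) (a : V) (x : {ffun V -> R}) : R :=
  \big[Num.min/x a]_(v in A) x v.

Lemma set_min_le A a x v : v \in A -> set_min A a x <= x v.
Proof. by move=> vA; apply: bigmin_le_cond. Qed.

Lemma set_min_attained A a x : a \in A -> exists2 v, v \in A & set_min A a x = x v.
Proof.
move=> aA; have /bigmin_leP[le|[v vA le]] := lexx (set_min A a x).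
  by exists a => //; apply/le_anti; rewrite set_min_le.
by exists v => //; apply/le_anti; rewrite set_min_le.
Qed.

Lemma set_min_eq A a x m : a \in A -> (forall v, v \in A -> m <= x v) ->
  (exists2 v, v \in A & x v = m) -> set_min A a x = m.
Proof.
move=> aA mle [v vA vm]; apply/le_anti; rewrite -{1}vm set_min_le //=.
by have [w wA ->] := set_min_attained A a x aA; apply: mle.
Qed.

Lemma pl_set_min (U : finType) A a (F : {ffun U -> R} -> {ffun V -> R}) :
  (forall v, pl_fun (F^~ v)) -> pl_fun (fun y => set_min A a (F y)).
Proof.
move=> plF.
by apply: (pl_big _ _ (F^~ a) _ _ (fun v => F^~ v)) => //; exact: pl_min.
Qed.

End SetMin.

Lemma sum_indicator {R : realType} {V : finType} (A : {set V}) (c : R) :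
  (\sum_v (v \in A)%:R * c = #|A|%:R * c)%R.
Proof. by rewrite -mulr_suml -natr_sum -sum1_card [in RHS]big_mkcond. Qed.

(** * Inverse stellar subdivisions *)

Section StellarWeld.
Local Open Scope classical_set_scope.
Local Open Scope ring_scope.
Context {R : realType} {V : finType}.

(* The right-hand complex restricted to A, C and w is the boundary of the
   simplex on the union of A and C; the left-hand one is its stellar
   subdivision at the face A, with w the new vertex. *)
Lemma pl_iso_stellar_weld (A C : {set V}) (w a : V) (L : set {set V}) :
  a \in A -> w \notin A -> w \notin C -> (forall v, v \in C -> v \notin A) ->
  (forall F G : {set V}, F \subset G -> L G -> L F) ->
  (forall F G, (F :\: (w |: (A :|: C)) = G :\: (w |: (A :|: C)))%SET ->
    L F -> L G) ->
  pl_iso (R := R)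
    [set F : {set V} | [/\ ~~ (A \subset F), ~~ (w |: C \subset F)%SET & L F]]
    [set F : {set V} | [/\ w \notin F, ~~ (A :|: C \subset F)%SET & L F]].
Proof.
move=> aA wA wC AC Ldown Lext.
set D := [set F : {set V} | [/\ ~~ (A \subset F), _ & _]]; set E := (X in pl_iso D X).
have neqA v : v \in A -> (v == w) = false by apply: contraTF => /eqP ->.
have neqC v : v \in C -> (v == w) = false by apply: contraTF => /eqP ->.
have A0 : #|A|%:R != 0 :> R by rewrite pnatr_eq0 -lt0n; apply/card_gt0P; exists a.
have A_gt0 : 0 < #|A|%:R :> R by rewrite lt_def A0 ler0n.
(* [f] is linear and sends the vertex [w] to the barycenter of [A]. [g] takes out of [y] the largest
   multiple of this barycenter and puts its mass on [w]. *)
pose f (x : {ffun V -> R}) : {ffun V -> R} :=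
  [ffun v => x v + (v \in A)%:R * (x w / #|A|%:R) - (v \in [set w]%SET)%:R * x w].
pose t (y : {ffun V -> R}) := set_min A a y.
pose g (y : {ffun V -> R}) : {ffun V -> R} :=
  [ffun v => y v - (v \in A)%:R * t y + (v \in [set w]%SET)%:R * (#|A|%:R * t y)].
have f_w x : f x w = 0 by rewrite ffunE (negPf wA) inE eqxx /=; lra.
have f_A x v : v \in A -> f x v = x v + x w / #|A|%:R.
  by move=> vA; rewrite ffunE vA inE neqA //=; lra.
have f_out x v : v != w -> v \notin A -> f x v = x v.
  by move=> vw vA; rewrite ffunE (negPf vA) inE (negPf vw) /=; lra.
have g_w y : g y w = y w + #|A|%:R * t y.
  by rewrite ffunE (negPf wA) inE eqxx /=; lra.
have g_A y v : v \in A -> g y v = y v - t y.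
  by move=> vA; rewrite ffunE vA inE neqA //=; lra.
have g_out y v : v != w -> v \notin A -> g y v = y v.
  by move=> vw vA; rewrite ffunE (negPf vA) inE (negPf vw) /=; lra.
have sum_f x : \sum_v f x v = \sum_v x v.
  under eq_bigr do rewrite ffunE.
  rewrite big_split big_split sumrN !sum_indicator /= cards1 mulrC divfK //; lra.
have sum_g y : \sum_v g y v = \sum_v y v.
  under eq_bigr do rewrite ffunE.
  by rewrite big_split sumrB !sum_indicator /= cards1; lra.
have out_Z v : v \notin (w |: (A :|: C))%SET -> v != w /\ v \notin A.
  by rewrite !inE !negb_or => /and3P[].
apply: (pl_isoW D E f g).
- apply: (pl_map_realization D f (fun=> f)) => //.
    move=> F G FG [AG CG LG]; split; last exact: Ldown LG.
    + by apply: contra AG => /fintype.subset_trans; apply.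
    + by apply: contra CG => /fintype.subset_trans; apply.
  move=> _ v; apply: (pl_fun_ext (fun x => x v + ((v \in A)%:R / #|A|%:R) * x w
    + (- (v \in [set w]%SET)%:R) * x w)).
    by move=> x; rewrite ffunE mulNr -mulrA [_^-1 * _]mulrC.
  by do !apply: pl_add; try apply: pl_scale; apply: pl_coord.
- move=> x [x0 x1 [AF CF LF]].
  have fE v : v \notin A -> v != w -> f x v = x v by move=> *; exact: f_out.
  have xw0 : 0 <= x w / #|A|%:R by rewrite divr_ge0.
  split; [split=> [v||]|].
  + have [->|vw] := eqVneq v w; first by rewrite f_w.
    have [vA|vA] := boolP (v \in A); last by rewrite f_out.
    by rewrite f_A // addr_ge0.
  + by rewrite sum_f.
  + split.
    * by rewrite inE f_w eqxx.
    (* Otherwise the support of [x] would contain [A] if [x w] vanishes, and both [w] and [C] if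
       not. *)
    * apply/negP => /fintype.subsetP ACF.
      have [xw|xw] := eqVneq (x w) 0.
        case/negP: AF; apply/fintype.subsetP => v vA.
        have := ACF v; rewrite !inE vA f_A // xw mul0r addr0; exact.
      case/negP: CF; apply/fintype.subsetP => v.
      rewrite !inE => /predU1P[->//|vC].
      have := ACF v; rewrite !inE vC orbT f_out ?AC ?neqC //; exact.
    * apply: Lext LF; apply/setP => v; rewrite !finset.in_setD.
      have [//|/out_Z[vw vA]] := boolP (v \in _); by rewrite !inE f_out.
  + have tE : t (f x) = x w / #|A|%:R.
      apply: set_min_eq => // [v vA|]; first by rewrite f_A // lerDr.
      have [v vA vF] := fintype.subsetPn AF; exists v => //.
      by move: vF; rewrite f_A // inE negbK => /eqP ->; rewrite add0r.
    apply/ffunP => v; have [->|vw] := eqVneq v w.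
      by rewrite g_w f_w tE add0r mulrC divfK.
    have [vA|vA] := boolP (v \in A); last by rewrite g_out // f_out.
    by rewrite g_A // f_A // tE addrK.
- move=> y [y0 y1 [wF ACF LF]].
  have yw : y w = 0 by move: wF; rewrite inE negbK => /eqP.
  have t0 : 0 <= t y by have [v _] := set_min_attained A a y aA; rewrite -/(t y) => ->.
  split; [split=> [v||]|].
  + have [->|vw] := eqVneq v w; first by rewrite g_w addr_ge0 ?mulr_ge0 ?ler0n.
    have [vA|vA] := boolP (v \in A); last by rewrite g_out.
    by rewrite g_A // subr_ge0; apply: set_min_le.
  + by rewrite sum_g.
  + split.
    * have [v vA tv] := set_min_attained A a y aA.
      apply/fintype.subsetPn; exists v => //.
      by rewrite inE g_A // /t tv subrr eqxx.
    * apply/negP => /fintype.subsetP CF; case/negP: ACF.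
      have t_gt0 : 0 < t y.
        rewrite lt_def t0 andbT; apply: contraTneq (CF w (finset.setU11 _ _)) => tE.
        by rewrite inE g_w yw tE mulr0 addr0 eqxx.
      apply/fintype.subsetP => v; rewrite !inE => /orP[vA|vC].
        by rewrite gt_eqF // (lt_le_trans t_gt0) // set_min_le.
      by have := CF v; rewrite !inE vC orbT g_out ?AC ?neqC // => ->.
    * apply: Lext LF; apply/setP => v; rewrite !finset.in_setD.
      have [//|/out_Z[vw vA]] := boolP (v \in _); by rewrite !inE g_out.
  + apply/ffunP => v; have [->|vw] := eqVneq v w; first by rewrite f_w yw.
    have [vA|vA] := boolP (v \in A); last by rewrite f_out // g_out.
    by rewrite f_A // g_A // g_w yw add0r mulrAC divff // mul1r subrK.
Qed.

End StellarWeld.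

(** * Adding one facet of a shelling *)

(* [T] is the face of the new facet complementary to its restriction face [S],
   and [r] sends each vertex of [S] to the vertex outside [S] and [T] that can
   replace it. The star of [T] is [T] joined with a product of fans, on which
   the coordinates outside [T] are recovered from the slopes [x v - x (r v)].
   Shifting all slopes along [S] by [s] and compensating on [T] gives a flow
   that preserves the sum of the coordinates. *)
Section FacetFlow.
Local Open Scope classical_set_scope.
Local Open Scope ring_scope.
Context {R : realType} {V : finType} (S T : {set V}) (r : V -> V) (a b : V).
Context (aS : a \in S) (bT : b \in T) (ST : forall v, v \in S -> v \notin T)
  (rS : forall v, v \in S -> r v \notin S) (rT : forall v, v \in S -> r v \notin T)
  (r_out : forall v, v \notin S -> v \notin T -> r v = v).
Implicit Types (x y z : {ffun V -> R}) (F : {set V}) (s : R).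

(** Each [w] outside [S] and [T] forms a block with the vertices of [S] that [r] sends to it. A face
    is a set containing no whole block, so this is the join of the simplex on [T] with the
    boundaries of the simplices on the blocks. *)
Definition facet_star : set {set V} :=
  [set F | forall w, w \notin S -> w \notin T -> w \in F ->
    exists v, [/\ v \in S, r v = w & v \notin F]].

Definition slope x : {ffun V -> R} := [ffun v => x v - x (r v)].
Definition shift x s : {ffun V -> R} := [ffun v => x v - s].
(** On a point of the star the least coordinate in each block is 0, so the coordinate at [w] is the
    largest difference [x w - x v] over its block, and this difference is the opposite of a
    slope. *)
Definition height y w : R := \big[Num.max/0]_(v | (v \in S) && (r v == w)) - y v.
Definition lift y v : R := (if v \in S then y v else 0) + height y (r v).
Definition excess y : R := \sum_(v | v \notin T) height y (r v).
Definition flow s x : {ffun V -> R} :=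
  [ffun v => if v \in T then x v + (\sum_(u | u \notin T) x u -
      \sum_(u | u \notin T) lift (shift (slope x) s) u) / #|T|%:R
    else lift (shift (slope x) s) v].

Definition low x : R := set_min S a (slope x).
Definition base x : R := set_min T b x.
Definition energy x : R := #|T|%:R * base x + excess (slope x).

(* Along the flow [low] decreases at rate 1 and [energy] increases at rate
   [#|S|]. At time [forward x] the flow brings [low] down to the opposite of
   [energy x / #|~: T|], provided that it starts above; as
   [excess <= - #|~: T| * low] when [low <= 0], the coordinates on [T] are still
   nonnegative at this time. [backward] recovers this time from the end point. *)
Definition forward x : R := Num.max 0 (low x + energy x / #|~: T|%:R).
Definition backward x : R :=
  Num.max 0 ((energy x + #|~: T|%:R * low x) / #|S|%:R).

Let T_gt0 : 0 < #|T|%:R :> R.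
Proof. by rewrite ltr0n; apply/card_gt0P; exists b. Qed.
Let S_gt0 : 0 < #|S|%:R :> R.
Proof. by rewrite ltr0n; apply/card_gt0P; exists a. Qed.
Let M_gt0 : 0 < #|~: T|%:R :> R.
Proof. by rewrite ltr0n; apply/card_gt0P; exists a; rewrite inE ST. Qed.

Lemma rK v : v \notin T -> r (r v) = r v.
Proof.
move=> vT; have [vS|vS] := boolP (v \in S); last by rewrite !r_out.
by rewrite r_out ?rS ?rT.
Qed.

Lemma rNT v : v \notin T -> r v \notin T.
Proof.
by move=> vT; have [/rT//|vS] := boolP (v \in S); rewrite r_out.
Qed.

Lemma rNS v : v \notin T -> r v \notin S.
Proof.
by move=> vT; have [/rS//|vS] := boolP (v \in S); rewrite r_out.
Qed.

Lemma height_ge0 y w : 0 <= height y w.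
Proof. exact: bigmax_ge_id. Qed.

Lemma height_ge y v : v \in S -> - y v <= height y (r v).
Proof. by move=> vS; apply: (le_bigmax_cond _ (fun v => - y v)); rewrite vS eqxx. Qed.

Lemma height_le y s w : s <= 0 -> (forall v, v \in S -> s <= y v) ->
  height y w <= - s.
Proof.
move=> s0 sy; apply: bigmax_le => [|v /andP[vS _]]; first by rewrite oppr_ge0.
by rewrite lerN2 sy.
Qed.

Lemma height_attained y w : height y w = 0 \/
  exists2 v, v \in S & r v = w /\ height y w = - y v.
Proof.
have /bigmax_geP[h0|[v /andP[vS /eqP vw] hv]] := lexx (height y w).
  by left; apply/le_anti; rewrite h0 height_ge0.
right; exists v => //; split=> //; apply/le_anti; rewrite hv -vw.
by rewrite height_ge.
Qed.

Lemma eq_height y z w : (forall v, v \in S -> y v = z v) ->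
  height y w = height z w.
Proof. by move=> yz; apply: eq_bigr => v /andP[vS _]; rewrite yz. Qed.

Lemma eq_lift y z v : (forall v, v \in S -> y v = z v) -> lift y v = lift z v.
Proof.
move=> yz; rewrite /lift (eq_height _ _ _ yz); case: ifP => // vS.
by rewrite yz.
Qed.

Lemma eq_excess y z : (forall v, v \in S -> y v = z v) -> excess y = excess z.
Proof. by move=> yz; apply: eq_bigr => v _; apply: eq_height. Qed.

Lemma excess_ge0 y : 0 <= excess y.
Proof. by apply: sumr_ge0 => v _; apply: height_ge0. Qed.

Lemma excess_le y s : s <= 0 -> (forall v, v \in S -> s <= y v) ->
  excess y <= - (#|~: T|%:R * s).
Proof.
move=> s0 sy; rewrite -mulrN mulr_natl -sumr_const.
rewrite [leRHS](eq_bigl (fun v => v \notin T)) => [|v]; last by rewrite inE.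
by apply: ler_sum => v _; apply: height_le.
Qed.

Lemma lift_ge0 y v : v \notin T -> 0 <= lift y v.
Proof.
rewrite /lift; case: ifP => [vS _|_ _]; last by rewrite add0r height_ge0.
by rewrite -lerBlDl sub0r height_ge.
Qed.

Lemma sum_lift y :
  \sum_(v | v \notin T) lift y v = \sum_(v in S) y v + excess y.
Proof.
rewrite big_split /=; congr (_ + _); rewrite -big_mkcondr /=.
by apply: eq_bigl => v; apply: andb_idl; apply: ST.
Qed.

Lemma slope_flow s x v : v \in S -> slope (flow s x) v = slope x v - s.
Proof.
move=> vS; rewrite ffunE !ffunE (negPf (ST _ vS)) (negPf (rT _ vS)).
rewrite /lift vS (negPf (rS _ vS)) rK ?ST // !ffunE; lra.
Qed.

(** Outside [T] the result depends only on the slopes along [S], which the first flow shifts by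
    [s']; on [T] the two compensations telescope. *)
Lemma flow_flow s s' x : flow s (flow s' x) = flow (s' + s) x.
Proof.
have E v : lift (shift (slope (flow s' x)) s) v = lift (shift (slope x) (s' + s)) v.
  apply: eq_lift => u uS; rewrite ffunE slope_flow // [RHS]ffunE; lra.
apply/ffunP => v; rewrite [LHS]ffunE [RHS]ffunE E; case: ifP => // vT.
rewrite (eq_bigr _ (fun u _ => E u)) ffunE vT.
have -> : \sum_(u | u \notin T) flow s' x u =
    \sum_(u | u \notin T) lift (shift (slope x) s') u.
  by apply: eq_bigr => u /negPf uT; rewrite ffunE uT.
rewrite -addrA -mulrDl; congr (_ + _ / _); lra.
Qed.

Lemma sum_flow s x : \sum_v flow s x v = \sum_v x v.
Proof.
rewrite (bigID (mem T)) [RHS](bigID (mem T)) /=.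
rewrite (eq_bigr (fun v => x v + (\sum_(u | u \notin T) x u -
      \sum_(u | u \notin T) lift (shift (slope x) s) u) / #|T|%:R)); last first.
  by move=> v vT; rewrite ffunE vT.
rewrite [X in _ + X](eq_bigr (lift (shift (slope x) s))); last first.
  by move=> v /negPf vT; rewrite ffunE vT.
rewrite big_split sumr_const -[_ / _ *+ _]mulr_natr.
rewrite divfK ?gt_eqF //=; lra.
Qed.

Lemma low_flow s x : low (flow s x) = low x - s.
Proof.
apply: set_min_eq => // [v vS|]; first by rewrite slope_flow // lerB ?set_min_le.
have [v vS E] := set_min_attained S a (slope x) aS.
by exists v => //; rewrite slope_flow // /low E.
Qed.

(* The coordinates of [x] outside [T] are determined by its slopes. *)
Definition balanced x := forall v, v \notin T -> lift (slope x) v = x v.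

Lemma flow0 x : balanced x -> flow 0 x = x.
Proof.
move=> xb; have E v : lift (shift (slope x) 0) v = lift (slope x) v.
  by apply: eq_lift => u _; rewrite ffunE subr0.
apply/ffunP => v; rewrite ffunE E; case: ifP => [vT|/negbT/xb//].
rewrite [X in _ - X](eq_bigr x); first by rewrite subrr mul0r addr0.
by move=> u uT; rewrite E xb.
Qed.

(** All coordinates on [T] change by the same amount, in total [#|S| * s] plus the loss of [excess].
    Counting the excess in the energy cancels this loss. *)
Lemma energy_flow s x : balanced x ->
  energy (flow s x) = energy x + #|S|%:R * s.
Proof.
move=> xb; pose d := (\sum_(u | u \notin T) x u -
      \sum_(u | u \notin T) lift (shift (slope x) s) u) / #|T|%:R.
have bE : base (flow s x) = base x + d.
  apply: set_min_eq => // [v vT|]; first by rewrite ffunE vT lerD2r set_min_le.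
  have [v vT E] := set_min_attained T b x bT.
  by exists v => //; rewrite ffunE vT /base E.
have dE : #|T|%:R * d = #|S|%:R * s + excess (slope x) - excess (shift (slope x) s).
  rewrite /d mulrC divfK ?gt_eqF // -(eq_bigr _ xb) !sum_lift.
  rewrite [X in _ - (X + _)](eq_bigr (fun v => slope x v - s)); last first.
    by move=> v _; rewrite ffunE.
  by rewrite sumrB sumr_const -[s *+ _]mulr_natl; lra.
rewrite /energy bE mulrDr dE (eq_excess (slope (flow s x)) (shift (slope x) s)).
  lra.
by move=> v vS; rewrite slope_flow // [RHS]ffunE.
Qed.

Lemma low_le x v : v \in S -> low x <= slope x v.
Proof. exact: set_min_le. Qed.

Local Notation supp x := [set v | x v != 0]%SET.

(** A nonzero coordinate at [w] comes with a zero coordinate at some [v] of its block, and the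
    opposite of the slope at this [v] is [x w]. *)
Lemma star_balanced x : realization facet_star x -> balanced x.
Proof.
move=> [x0 _ xstar]; have hE w : w \notin S -> w \notin T -> height (slope x) w = x w.
  move=> wS wT; apply/le_anti/andP; split.
    by apply: bigmax_le => // v /andP[_ /eqP <-]; rewrite ffunE opprB gerBl.
  have [->|xw] := eqVneq (x w) 0; first exact: height_ge0.
  have [|v [vS <-]] := xstar w wS wT; first by rewrite inE.
  rewrite inE negbK => /eqP xv; apply: le_trans (height_ge _ _ vS).
  by rewrite ffunE xv sub0r opprK.
move=> v vT; rewrite /lift hE ?rNS ?rNT //; case: ifP => [_|/negbT vS].
  by rewrite ffunE subrK.
by rewrite add0r r_out.
Qed.

(** A lift has a zero coordinate in each block, since a nonzero height is attained by some [v] whose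
    coordinate it cancels. Only the signs on [T] are at stake. *)
Lemma star_flow s x : realization facet_star x -> 0 <= base (flow s x) ->
  realization facet_star (flow s x).
Proof.
move=> [_ x1 _] bge; split=> [v||w wS wT].
- have [vT|vT] := boolP (v \in T); first exact: le_trans bge (set_min_le _ _ _ _ vT).
  by rewrite ffunE (negPf vT) lift_ge0.
- by rewrite sum_flow.
rewrite inE ffunE (negPf wT) /lift (negPf wS) add0r r_out //.
have [->|[v vS [<- E]] _] := height_attained (shift (slope x) s) w.
  by rewrite eqxx.
exists v; split=> //; rewrite inE negbK ffunE (negPf (ST _ vS)) /lift vS E.
by rewrite subrr.
Qed.

(** The faces of the star that survive the removal are those not containing [S]; the sign of [low]
    detects them. *)
Lemma star_low_le0 x : realization facet_star x ->
  ~~ (S \subset supp x) <-> low x <= 0.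
Proof.
move=> [x0 _ xstar]; split=> [/fintype.subsetPn[v vS]|].
  rewrite inE negbK => /eqP xv; apply: le_trans (low_le x v vS) _.
  by rewrite ffunE xv sub0r oppr_le0.
have [v vS E] := set_min_attained S a (slope x) aS; rewrite /low E ffunE subr_le0.
have [xr|xr _] := eqVneq (x (r v)) 0.
  rewrite xr => xv; apply/fintype.subsetPn; exists v => //.
  by rewrite inE negbK eq_le xv x0.
have [|u [uS _ uF]] := xstar (r v) (rS _ vS) (rT _ vS); first by rewrite inE.
by apply/fintype.subsetPn; exists u.
Qed.

Lemma base_ge0 x : (forall v, 0 <= x v) -> 0 <= base x.
Proof. by move=> x0; have [v _ E] := set_min_attained T b x bT; rewrite /base E. Qed.

Lemma energy_ge0 x : (forall v, 0 <= x v) -> 0 <= energy x.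
Proof.
by move=> x0; rewrite addr_ge0 ?excess_ge0 // mulr_ge0 ?base_ge0 // ltW.
Qed.

Lemma base_ge0_energy x : excess (slope x) <= energy x -> 0 <= base x.
Proof. by rewrite lerDr pmulr_rge0. Qed.

Lemma excess_slope_le x s : s <= 0 -> s <= low x ->
  excess (slope x) <= - (#|~: T|%:R * s).
Proof.
move=> s0 sl; apply: excess_le => // v vS.
exact: le_trans sl (low_le x v vS).
Qed.

Lemma forwardP x : realization facet_star x ->
  [/\ realization facet_star (flow (forward x) x),
      low (flow (forward x) x) <= 0 &
      backward (flow (forward x) x) = forward x].
Proof.
move=> xstar; have xb := star_balanced _ xstar; have [x0 _ _] := xstar.
have k0 := energy_ge0 _ x0; have M0 := M_gt0; set M := #|~: T|%:R in M0 *.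
rewrite /backward low_flow energy_flow // -/M.
have [le|gt] := lerP (low x + energy x / M) 0.
  have fE : forward x = 0 by apply: max_l.
  have l0 : low x <= 0.
    by apply: le_trans le; rewrite lerDl divr_ge0 // ltW.
  rewrite fE flow0 // subr0 mulr0 addr0; split=> //.
  apply: max_l; rewrite pmulr_lle0 ?invr_gt0 //.
  by rewrite -(ler_pM2r M0) mul0r mulrDl divfK ?gt_eqF // mulrC addrC in le.
have fE : forward x = low x + energy x / M by apply: max_r; rewrite ltW.
have lE : low (flow (forward x) x) = - (energy x / M) by rewrite low_flow fE; lra.
have l0 : low (flow (forward x) x) <= 0 by rewrite lE oppr_le0 divr_ge0 // ltW.
have eE := energy_flow (forward x) _ xb.
split.
(* By the choice of the time, the excess is at most the initial energy, and the energy has not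
   decreased since. *)
- apply: star_flow => //; apply: base_ge0_energy.
  apply: le_trans (excess_slope_le _ _ l0 (lexx _)) _.
  rewrite lE mulrN opprK mulrC divfK ?gt_eqF // eE lerDl mulr_ge0 ?ltW //.
  by rewrite fE.
- by rewrite -low_flow.
- rewrite -low_flow lE mulrN [M * _]mulrC divfK ?gt_eqF //.
  rewrite addrAC subrr add0r mulrAC divff ?gt_eqF // mul1r.
  by apply: max_r; rewrite fE ltW.
Qed.

Lemma backwardP x : realization facet_star x -> low x <= 0 ->
  realization facet_star (flow (- backward x) x) /\
  forward (flow (- backward x) x) = backward x.
Proof.
move=> xstar l0; have xb := star_balanced _ xstar.
have M0 := M_gt0; set M := #|~: T|%:R in M0 *.
rewrite /forward low_flow energy_flow // -/M.
have [le|gt] := lerP ((energy x + M * low x) / #|S|%:R) 0.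
  have bE : backward x = 0 by apply: max_l.
  rewrite bE oppr0 flow0 // subr0 mulr0 addr0; split=> //.
  apply: max_l; rewrite pmulr_lle0 ?invr_gt0 // in le.
  by rewrite -(ler_pM2r M0) mul0r mulrDl divfK ?gt_eqF // mulrC addrC.
have bE : backward x = (energy x + M * low x) / #|S|%:R by apply: max_r; rewrite ltW.
have b0 : 0 <= backward x by rewrite bE ltW.
have eE : energy x + #|S|%:R * - backward x = - (M * low x).
  by rewrite bE mulrN [#|S|%:R * _]mulrC divfK ?gt_eqF //; lra.
split; last first.
  rewrite eE opprK mulNr [M * _]mulrC mulfK ?gt_eqF //.
  by rewrite addrAC subrr add0r; apply: max_r.
(* Going back does not decrease [low] and leaves the energy equal to [- (M * low x)], which bounds
   the excess. *)
apply: star_flow => //; apply: base_ge0_energy; rewrite energy_flow // eE.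
apply: excess_slope_le => //; rewrite low_flow; lra.
Qed.

(** The flow stands still where the star meets the other faces, so that it can be extended by the
    identity. *)
Lemma forward0 x : (forall v, 0 <= x v) -> low x <= 0 -> base x <= 0 ->
  forward x = 0.
Proof.
move=> x0 l0 b0; apply: max_l.
have -> : energy x = excess (slope x).
  rewrite /energy (_ : base x = 0) ?mulr0 ?add0r //.
  by apply/le_anti; rewrite b0 base_ge0.
rewrite -(ler_pM2r M_gt0) mul0r mulrDl divfK ?gt_eqF //.
by have := excess_slope_le _ _ l0 (lexx _); lra.
Qed.

Lemma pl_height (U : finType) (y : {ffun U -> R} -> {ffun V -> R}) w :
  (forall v, pl_fun (y^~ v)) -> pl_fun (fun u => height (y u) w).
Proof.
move=> ply; apply: (pl_big _ _ (fun=> 0) _ _ (fun v u => - y u v)).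
- exact: pl_max.
- exact: pl_const.
- by move=> v _; apply: pl_opp.
Qed.

Lemma pl_slope v : pl_fun (fun x => slope x v).
Proof.
apply: (pl_fun_ext (fun x => x v - x (r v))) => [x|]; first by rewrite ffunE.
by apply: pl_sub; apply: pl_coord.
Qed.

Lemma pl_forward : pl_fun forward.
Proof.
have pllow : pl_fun low by apply: pl_set_min; apply: pl_slope.
apply: pl_max; first exact: pl_const.
apply: pl_add => //; apply: (pl_fun_ext (fun x => #|~: T|%:R^-1 * energy x)).
  by move=> x; rewrite mulrC.
apply/pl_scale/pl_add.
  by apply/pl_scale/(pl_set_min _ _ _ id) => v; apply: pl_coord.
by apply: pl_sum => v _; apply: pl_height; apply: pl_slope.
Qed.

Lemma pl_flow_forward v : pl_fun (fun x => flow (forward x) x v).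
Proof.
have plslope w : pl_fun (fun x => shift (slope x) (forward x) w).
  apply: (pl_fun_ext (fun x => slope x w - forward x)) => [x|].
    by rewrite [RHS]ffunE.
  by apply: pl_sub; [apply: pl_slope | apply: pl_forward].
have pllift w : pl_fun (fun x => lift (shift (slope x) (forward x)) w).
  apply: pl_add; last exact: pl_height.
  by case: (w \in S) => //; apply: pl_const.
have [vT|vT] := boolP (v \in T); last first.
  by apply: pl_fun_ext (pllift v) => x; rewrite [RHS]ffunE (negPf vT).
apply: (pl_fun_ext (fun x => x v + #|T|%:R^-1 * (\sum_(u | u \notin T) x u -
      \sum_(u | u \notin T) lift (shift (slope x) (forward x)) u))).
  by move=> x; rewrite [RHS]ffunE vT mulrC.
apply: pl_add; first exact: pl_coord.
apply/pl_scale/pl_sub; first by apply: pl_sum => u _; apply: pl_coord.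
by apply: pl_sum => u _; apply: pllift.
Qed.

(** The map is the flow up to the time [forward] on the star of [T], and the identity elsewhere; its
    inverse flows back by [backward]. *)
Lemma pl_iso_remove_facet (D B : set {set V}) :
  (forall F G : {set V}, F \subset G -> D G -> D F) ->
  B `<=` D -> (forall F, D F -> B F \/ facet_star F) -> facet_star `<=` D ->
  (forall F, facet_star F -> ~~ (S \subset F) -> B F) ->
  (forall F, B F -> ~~ (S \subset F)) ->
  (forall F, B F -> facet_star F \/ ~~ (T \subset F)) ->
  pl_iso (R := R) D B.
Proof.
move=> Ddown BD DB starD starB BS BT.
pose f x := if `[< facet_star (supp x) >] then flow (forward x) x else x.
pose g x := if `[< facet_star (supp x) >] then flow (- backward x) x else x.
have BlowP x : (forall v, 0 <= x v) -> B (supp x) -> low x <= 0.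
  move=> x0 /BS/fintype.subsetPn[v vS]; rewrite inE negbK => /eqP xv.
  by apply: le_trans (low_le _ _ vS) _; rewrite ffunE xv sub0r oppr_le0.
apply: (pl_isoW D B f g).
- apply: (pl_map_realization D f (fun F x =>
    if `[< facet_star F >] then flow (forward x) x else x)) => //.
    move=> F v; case: asboolP => _; first exact: pl_flow_forward.
    exact: pl_coord.
  move=> F x DF [x0 x1 xD] xF; rewrite /f.
  have [sF|nsF] := pselect (facet_star F).
    rewrite !asboolT // => w wS wT /(fintype.subsetP xF)/(sF w wS wT)[v [vS vw vF]].
    by exists v; split=> //; apply: contra vF; apply: (fintype.subsetP xF).
  (* The point lies in the star but [F] does not, so the formula for [F] is the identity. As [F]
     misses a vertex of [S] and one of [T], [forward] vanishes at the point and both formulas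
     agree. *)
  rewrite (asboolF nsF); case: asboolP => // xstar.
  have BF : B F by case: (DB F DF).
  have TF : ~~ (T \subset F) by case: (BT F BF).
  have [v vS vF] := fintype.subsetPn (BS F BF).
  have [w wT wF] := fintype.subsetPn TF.
  have xout u : u \notin F -> x u = 0.
    move=> uF; apply/eqP; apply: contraNT uF => xu.
    by apply: (fintype.subsetP xF); rewrite inE.
  rewrite forward0 ?flow0 //; first exact: star_balanced.
    by apply: le_trans (low_le _ _ vS) _; rewrite ffunE xout // sub0r oppr_le0.
  by rewrite -(xout w wF); apply: set_min_le.
- move=> x [x0 x1 xD]; rewrite /f; case: asboolP => xstar; last first.
    have xB : B (supp x) by case: (DB _ xD).
    by split=> //; rewrite /g asboolF.
  have xs : realization facet_star x by [].
  have [zs l0 bf] := forwardP x xs; have [z0 z1 zstar] := zs.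
  split; first by split=> //; apply: starB => //; apply/star_low_le0.
  rewrite /g asboolT // bf flow_flow subrr flow0 //; exact: star_balanced.
- move=> x [x0 x1 xB]; rewrite /g; case: asboolP => xstar; last first.
    by split; [split=> //; exact: BD | rewrite /f asboolF].
  have xs : realization facet_star x by [].
  have [zs fb] := backwardP x xs (BlowP x x0 xB); have [z0 z1 zstar] := zs.
  split; first by split=> //; apply: starD.
  rewrite /f asboolT // fb flow_flow addNr flow0 //; exact: star_balanced.
Qed.

End FacetFlow.

(** * Monomial ideals *)

Section MonomialIdeals.
Local Open Scope classical_set_scope.
Local Open Scope ring_scope.
Context {K : fieldType}.

Lemma mem_monomial_ideal (n : nat) (M : set 'X_{1..n}) (f : {mpoly K[n]}) :
  ideal_gen [set 'X_[m] | m in M] f <->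
  forall q, q \in msupp f -> exists2 m, M m & (m <= q)%MM.
Proof.
split=> [[s [sM ->]]|fM].
  rewrite big_seq; apply: (big_ind (fun g : {mpoly K[n]} =>
    forall q, q \in msupp g -> exists2 m, M m & (m <= q)%MM)).
  - by move=> q; rewrite msupp0.
  - move=> g h IHg IHh q /msuppD_le; rewrite mem_cat => /orP[/IHg|/IHh] //.
  - move=> c /sM[m Mm <-] q; rewrite (perm_mem (msuppMX _ _)) => /mapP[k _ ->].
    by exists m => //; apply: lem_addr.
have /choice[h hP] : forall q, exists m, q \in msupp f -> M m /\ (m <= q)%MM.
  move=> q; have [/fM[m Mm mq]|] := boolP (q \in msupp f); first by exists m.
  by exists q.
exists [seq (f@_q *: 'X_[(q - h q)%MM], 'X_[h q]) | q <- msupp f]; split.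
  by move=> _ /mapP[q /hP[Mh _] ->]; exists (h q).
rewrite big_map /= [LHS]mpolyE; apply: eq_big_seq => q /hP[_ hq].
by rewrite -scalerAl -mpolyXD submK.
Qed.

Context {V : finType}.
Implicit Types (F G : {set V}) (q m : 'X_{1..#|{: V}|}).

Definition set_mnm F : 'X_{1..#|{: V}|} :=
  [multinom (enum_val i \in F : nat) | i < #|{: V}|].
Definition mnm_set q : {set V} := [set v | q (enum_rank v) != 0%N]%SET.

Lemma set_mnm_le F q : (set_mnm F <= q)%MM = (F \subset mnm_set q).
Proof.
apply/mnm_lepP/fintype.subsetP => [H v vF|H i].
  by rewrite inE -lt0n; have := H (enum_rank v); rewrite mnmE enum_rankK vF.
rewrite mnmE; case: (boolP (_ \in F)) => // /H.
by rewrite inE enum_valK lt0n.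
Qed.

Lemma mnm_set_mnm F : mnm_set (set_mnm F) = F.
Proof. by apply/setP => v; rewrite inE mnmE enum_rankK eqb0 negbK. Qed.

Lemma mnm_setS q m : (q <= m)%MM -> mnm_set q \subset mnm_set m.
Proof.
move=> /mnm_lepP qm; apply/fintype.subsetP => v; rewrite !inE -!lt0n => q0.
exact: leq_trans (qm _).
Qed.

Lemma mdeg_set_mnm F : mdeg (set_mnm F) = #|F|.
Proof.
rewrite mdegE -sum1_card [RHS]big_mkcond.
rewrite [RHS](reindex (fun i : 'I_#|{: V}| => enum_val i)) /=; last first.
  by apply: onW_bij; exact: enum_val_bij.
by apply: eq_bigr => i _; rewrite mnmE; case: (_ \in F).
Qed.

Lemma prod_var F : \prod_(v in F) var K v = 'X_[set_mnm F].
Proof.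
rewrite /var -(big_morph (fun m => 'X_[m]) (@mpolyXD _ _) (@mpolyX0 _ _)).
congr 'X_[_]; apply/mnmP => i; rewrite mnm_sumE mnmE big_mkcond.
rewrite (bigD1 (enum_val i)) //= mnm1E enum_valK eqxx big1 ?addn0.
  by case: (_ \in F).
move=> v vi; rewrite mnm1E; case: eqP => [E|_]; last by case: ifP.
by rewrite -E enum_rankK eqxx in vi.
Qed.

(* Squarefree generators are encoded by their supports: the dual of such an
   ideal consists of the polynomials all of whose monomials are transversal to
   the family of supports. *)
Lemma mem_alexander_dual (H : set {set V}) (f : polyring K V) :
  alexander_dual (ideal_gen [set 'X_[set_mnm G] | G in H]) f <->
  forall q, q \in msupp f -> forall G, H G -> exists2 v, v \in G & v \in mnm_set q.
Proof.
have genE : [set 'X_[set_mnm G] | G in H] =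
    [set 'X_[m] | m in [set set_mnm G | G in H]] :> set (polyring K V).
  by rewrite image_comp.
have memI m : ideal_gen [set 'X_[set_mnm G] | G in H] ('X_[m] : polyring K V) <->
    exists2 G, H G & G \subset mnm_set m.
  rewrite genE mem_monomial_ideal msuppX; split=> [|[G HG Gm] q].
    case/(_ m (mem_head _ _)) => _ [G HG <-]; rewrite set_mnm_le.
    by exists G.
  rewrite inE => /eqP ->; exists (set_mnm G); first by exists G.
  by rewrite set_mnm_le.
set I := ideal_gen _ in memI *.
rewrite /alexander_dual; set M := [set g | exists2 _, _ & _].
have -> : M = [set 'X_[m] | m in [set m | forall m', I 'X_[m'] ->
    exists d : 'X_{1..#|{: V}|}, [/\ d != 0%MM, (d <= m)%MM & (d <= m')%MM]]].
  by apply/seteqP; split=> g [m]; [move=> ->|]; exists m.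
rewrite mem_monomial_ideal; split=> fP q qf.
  have [m mP mq] := fP q qf; move=> G HG.
  have [|d [d0 dm dG]] := mP (set_mnm G).
    by apply/memI; exists G; rewrite ?mnm_set_mnm.
  have [v vd] : exists v, v \in mnm_set d.
    apply/existsP; apply: contra_neqT d0 => /existsPn dP; apply/mnmP => i.
    have := dP (enum_val i); rewrite inE enum_valK negbK => /eqP ->.
    by rewrite mnm0E.
  exists v; last exact: (fintype.subsetP (mnm_setS _ _ (lepm_trans dm mq))).
  by have := fintype.subsetP (mnm_setS _ _ dG) v vd; rewrite mnm_set_mnm.
exists q => [m /memI[G HG Gm]|]; last exact: lepm_refl.
have [v vG vq] := fP q qf G HG; exists (set_mnm [set v]%SET).
rewrite !set_mnm_le !finset.sub1set vq (fintype.subsetP Gm) //; split=> //.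
apply/eqP => /(congr1 (fun m => v \in mnm_set m)).
by rewrite mnm_set_mnm finset.set11 inE mnm0E eqxx.
Qed.

(** Multiplying by the monomial of [G] leaves the exponents on a set disjoint from [G] unchanged, so
    divisibility by an earlier generator holds already before the multiplication. *)
Lemma disjoint_monomials_regular (s : seq {set V}) :
  uniq s -> (forall F G, F \in s -> G \in s -> F != G -> (F :&: G = finset.set0)%SET) ->
  (forall F, F \in s -> F != finset.set0) ->
  regular_sequence [seq 'X_[set_mnm F] : polyring K V | F <- s].
Proof.
move=> s_uniq s_dis s_neq0.
have memS (t : seq {set V}) (f : polyring K V) :
    ideal_gen [set` [seq 'X_[set_mnm F] : polyring K V | F <- t]] f <->
    forall q, q \in msupp f -> exists2 F, F \in t & F \subset mnm_set q.
  have -> : [set` [seq 'X_[set_mnm F] : polyring K V | F <- t]] =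
      [set 'X_[m] | m in [set set_mnm F | F in [set` t]]].
    apply/seteqP; split=> g /=.
      by case/mapP => F Ft ->; exists (set_mnm F) => //; exists F.
    by case=> _ [F Ft <-] <-; apply/mapP; exists F.
  rewrite mem_monomial_ideal; split=> fP q /fP.
    by case=> _ [F Ft <-]; rewrite set_mnm_le => Fq; exists F.
  by case=> F Ft Fq; exists (set_mnm F); [exists F | rewrite set_mnm_le].
split=> [i|/memS]; last first.
  case/(_ 0%MM); first by rewrite msupp1 inE.
  move=> F Fs /fintype.subsetP F0; have /set0Pn[v vF] := s_neq0 F Fs.
  by have := F0 v vF; rewrite inE mnm0E eqxx.
rewrite size_map => i_lt f; rewrite (nth_map finset.set0) // -map_take.
move=> /memS fP; apply/memS => q qf; set G := nth _ s i in fP.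
have [|F Ft FGq] := fP (set_mnm G + q)%MM.
  by rewrite (perm_mem (msuppMX _ _)); apply: map_f.
exists F => //; have Gs : G \in s by apply: mem_nth.
have FG : F != G.
  apply: contraTneq Ft => ->; rewrite in_take // -leqNgt.
  by rewrite index_uniq.
apply/fintype.subsetP => v vF; have := fintype.subsetP FGq v vF.
rewrite !inE mnmDE mnmE enum_rankK.
case: (boolP (v \in G)) => // vG.
have := s_dis F G (mem_take Ft) Gs FG => /setP/(_ v).
by rewrite !inE vF vG.
Qed.

End MonomialIdeals.

(** * The complex of a poset ideal *)

Section Complex.
Local Open Scope classical_set_scope.
Context {d : Order.disp_t} {P : finPOrderType d} {n : nat}.
Implicit Types (phi psi : {ffun P -> 'I_n}) (J : set {ffun P -> 'I_n}).
Implicit Types (F : {set P * 'I_n}).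

Definition graph phi : {set P * 'I_n} := [set v | v.2 == phi v.1]%SET.

Definition facet_complex J : set {set P * 'I_n} :=
  [set F | exists2 phi, J phi & forall p, (p, phi p) \notin F].

Lemma graphE phi : graph phi = [set (p, phi p) | p in [set: P]%SET]%SET.
Proof.
apply/setP => -[p i]; rewrite inE; apply/eqP/imsetP => /= [->|[q _ [-> ->]]//].
by exists p.
Qed.

Lemma card_graph phi : #|graph phi| = #|P|.
Proof. by rewrite graphE card_imset ?cardsT // => p q []. Qed.

Lemma graph_monomialE (K : fieldType) phi :
  graph_monomial K phi = ('X_[set_mnm (graph phi)])%R.
Proof.
rewrite -prod_var graphE big_imset /=; last by move=> p q _ _ [].
by apply: eq_bigl => p; rewrite inE.
Qed.

Lemma coletterplace_idealE (K : fieldType) J : coletterplace_ideal K J =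
  ideal_gen [set ('X_[set_mnm G])%R | G in graph @` J].
Proof.
rewrite image_comp /coletterplace_ideal; congr ideal_gen.
by apply: eq_imagel => phi _ /=; exact: graph_monomialE.
Qed.

(** The monomial of [F] lies in the dual when [F] meets every graph, so the faces are the sets
    disjoint from some graph. *)
Lemma dual_complexE (K : fieldType) J : dual_complex K J = facet_complex J.
Proof.
apply/seteqP; split=> F; rewrite /dual_complex /stanley_reisner_complex /=;
  rewrite coletterplace_idealE prod_var mem_alexander_dual msuppX.
  move=> H; apply: contrapT => H'; apply: H => q; rewrite inE => /eqP ->.
  move=> _ [phi Jphi <-]; rewrite mnm_set_mnm; apply: contrapT => H''.
  apply: H'; exists phi => // p; apply/negP => pF; apply: H''.
  by exists (p, phi p); rewrite ?inE.
move=> [phi Jphi phiF] /(_ _ (mem_head _ _) _ (imageP graph Jphi)).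
rewrite mnm_set_mnm => -[[p i]]; rewrite inE => /eqP /= -> pF.
by have := phiF p; rewrite pF.
Qed.

End Complex.

(** * Removing the facet of a maximal map *)

Section FacetRemoval.
Local Open Scope classical_set_scope.
Context {R : realType} {d : Order.disp_t} {P : finPOrderType d} {n : nat}.
Implicit Types (phi psi : {ffun P -> 'I_n}) (J : set {ffun P -> 'I_n}).

Lemma minimal_element (A : pred P) (p : P) : A p ->
  exists2 q, A q & forall s, (s < q)%O -> ~~ A s.
Proof.
move=> Ap; case: (@arg_minnP _ p A (fun q => #|[set s | (s < q)%O]%SET|) Ap) => q Aq qmin.
exists q => // s sq; apply/negP => /qmin; rewrite leqNgt => /negP; apply.
apply: proper_card; apply/properP; split.
  by apply/fintype.subsetP => t; rewrite !inE => /lt_trans; apply.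
by exists s; rewrite inE ?ltxx.
Qed.

(* Lowering [phi] at the single element [v.1] to the value [v.2] gives a
   smaller isotone map. *)
Definition restriction_face phi : {set P * 'I_n} :=
  [set v : P * 'I_n | (v.2 < phi v.1)%N &&
    [forall q, (q < v.1)%O ==> (phi q <= v.2)%N]]%SET.
Definition free_face phi : {set P * 'I_n} :=
  [set v : P * 'I_n | (v \notin restriction_face phi) && (v.2 != phi v.1)]%SET.

(** A vertex [(p, i)] of [S] can be exchanged with the vertex [(p, phi p)] of the graph. Excluding
    the least map makes [S] nonempty, and excluding the exceptional case makes [T] nonempty. *)
Lemma pl_iso_remove_maximal (n_gt0 : (0 < n)%N) J phi : poset_ideal J ->
  J phi -> (forall psi, J psi -> pointwise_le phi psi -> psi = phi) ->
  phi <> [ffun => Ordinal n_gt0] -> ~ (antichain P /\ J = isotone_maps P 'I_n) ->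
  pl_iso (R := R) (facet_complex J) (facet_complex (J `\ phi)).
Proof.
move=> [Jiso Jdown] Jphi phimax phi0 Jexc; have phiiso := Jiso _ Jphi.
pose S := restriction_face phi; pose T := free_face phi.
pose r (v : P * 'I_n) := (v.1, phi v.1).
have SP p (i : 'I_n) :
    reflect ((i < phi p)%N /\ forall q, (q < p)%O -> (phi q <= i)%N)
      ((p, i) \in S).
  rewrite inE /=; apply: (iffP andP) => -[ip H]; split=> //.
    by move=> q; apply/implyP; move/forallP: H.
  by apply/forallP => q; apply/implyP/H.
have outE v : v \notin S -> v \notin T -> v.2 = phi v.1.
  by rewrite [v \in T]inE => ->; rewrite negbK => /eqP.
(* At a minimal element where [phi] is positive, all values below are 0, so the value there may be
   lowered to 0. *)
have [a aS] : exists a, a \in S.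
  have [p pP] : exists p, (0 < phi p)%N.
    apply/not_existsP => H; apply: phi0; apply/ffunP => p; rewrite ffunE.
    by apply/val_inj; have /negP := H p; rewrite -eqn0Ngt => /eqP.
  have [q qP qmin] := minimal_element (fun p => 0 < phi p)%N _ pP.
  exists (q, Ordinal n_gt0); apply/SP; split=> // s /qmin.
  by rewrite -leqNgt.
(* If [T] is empty, [phi] is constant at the last value, since a last value never occurs in [S]. For
   [p < q], the vertex of [q] with value 0 would then lie in [S] or on the graph only if the last
   value is 0, when [phi] is the least map. *)
have [b bT] : exists b, b \in T.
  apply/not_existsP => Tno; apply: Jexc.
  have last_lt : (n.-1 < n)%N by rewrite prednK.
  have phi_last p : phi p = Ordinal last_lt.
    apply: contra_notP (Tno (p, Ordinal last_lt)) => ne.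
    rewrite !inE /= !negb_and -leqNgt -ltnS prednK // ltn_ord /=.
    by apply/eqP => E; apply: ne.
  have anti : antichain P.
    move=> p q pq; apply/eqP; apply: contrapT => /negP npq.
    have ltpq : (p < q)%O by rewrite lt_def eq_sym npq.
    apply: phi0; apply/ffunP => s; rewrite ffunE phi_last; apply/val_inj => /=.
    have [/SP[_ /(_ p ltpq)]|qS] := boolP ((q, Ordinal n_gt0) \in S).
      by rewrite phi_last leqn0 => /eqP.
    have := outE _ qS (introN idP (Tno _)); rewrite phi_last.
    by case.
  split=> //; apply/seteqP; split=> // psi psiiso; apply: (Jdown phi) => // p.
  by rewrite phi_last leEord /= -ltnS prednK.
(* [psi] takes at each [p] a value [i] with [(p, i)] in [S] and not in [F], if there is one, and
   [phi p] otherwise. It is isotone because such an [i] bounds [phi] on all elements below [p]. *)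
have missing F : facet_star S T r F -> exists2 psi, J psi &
    (forall p, (p, psi p) \notin F) /\ (~~ (S \subset F) -> psi <> phi).
  move=> starF.
  have /choice[h hP] : forall p, exists i, (p, i) \notin F /\
      ((p, i) \in S \/ i = phi p /\ forall j, (p, j) \in S -> (p, j) \in F).
    move=> p; have [[i [iS iF]]|H] := pselect (exists i, (p, i) \in S /\ (p, i) \notin F).
      by exists i; split; [|left].
    exists (phi p).
    have notS j : (p, j) \in S -> (p, j) \in F.
      by move=> jS; apply/negPn/negP => jF; apply: H; exists j.
    split; last by right.
    apply/negP => pF.
    have pS : (p, phi p) \notin S by apply/SP => -[]; rewrite ltnn.
    have pT : (p, phi p) \notin T by rewrite inE eqxx andbF.
    have [[q i] [vS [vp _] vF]] := starF _ pS pT pF.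
    by apply: H; exists i; rewrite -vp.
  pose psi : {ffun P -> 'I_n} := [ffun p => h p].
  have psile : pointwise_le psi phi.
    move=> p; rewrite ffunE leEord; have [_ [/SP[/ltnW//]|[->//]]] := hP p.
  have psiiso : isotone_maps P 'I_n psi.
    move=> p q; rewrite le_eqVlt => /predU1P[->|pq]; first exact: lexx.
    apply: le_trans (psile p) _; rewrite ffunE.
    have [_ [/SP[_ H]|[-> _]]] := hP q; first by rewrite leEord; exact: H.
    exact/phiiso/ltW.
  exists psi; first exact: Jdown psiiso psile Jphi.
  split=> [p|/fintype.subsetPn[[p i] pS pF] E]; first by rewrite ffunE; case: (hP p).
  have := congr1 (fun f : {ffun P -> 'I_n} => f p) E; rewrite ffunE => hE.
  have [_ [/SP[]|[_ /(_ i pS)]]] := hP p; first by rewrite hE ltnn.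
  by rewrite (negPf pF).
apply: (pl_iso_remove_facet S T r a b aS bT) => //.
- by move=> v vS; rewrite inE vS.
- by move=> [p i] _; apply/SP => -[]; rewrite ltnn.
- by move=> [p i] _; rewrite inE eqxx andbF.
- by move=> [p i] vS vT; rewrite /r -(outE _ vS vT).
- move=> F G FG [psi Jpsi psiG]; exists psi => // p.
  by apply: contra (psiG p); apply: (fintype.subsetP FG).
- by move=> F [psi [Jpsi _] psiF]; exists psi.
- move=> F [psi Jpsi psiF].
  have [psiE|ne] := pselect (psi = phi); last by left; exists psi.
  right=> w wS wT; have := psiF w.1; rewrite psiE -(outE _ wS wT) -surjective_pairing.
  by move=> /negPf ->.
- by move=> F /missing[psi Jpsi [psiF _]]; exists psi.
- by move=> F /missing[psi Jpsi [psiF ne]] SF; exists psi => //; split=> //; exact: ne.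
(* By maximality of [phi], [psi] is smaller than [phi] somewhere; at a minimal such [q], isotonicity
   of [psi] puts [(q, psi q)] in [S]. *)
- move=> F [psi [Jpsi ne] psiF].
  have [p pP] : exists p, (psi p < phi p)%N.
    apply/not_existsP => H; apply: ne; apply: phimax => // p.
    by rewrite leEord leqNgt; apply/negP.
  have [q qP qmin] := minimal_element (fun p => psi p < phi p)%N _ pP.
  apply/fintype.subsetPn; exists (q, psi q) => //; apply/SP; split=> // s sq.
  have := qmin s sq; rewrite -leqNgt => /leq_trans; apply.
  by have := Jiso _ Jpsi s q (ltW sq); rewrite leEord.
(* If the graph of [psi] avoids [T], then wherever [F] contains a vertex [(p, phi p)], the vertex
   [(p, psi p)] is in [S] and is missed by [F]. *)
- move=> F [psi [Jpsi ne] psiF].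
  have [[p pT]|H] := pselect (exists p, (p, psi p) \in T).
    by right; apply/fintype.subsetPn; exists (p, psi p).
  left=> -[p i] wS wT wF; exists (p, psi p); split=> //; last first.
    by rewrite /r -(outE _ wS wT).
  apply/negPn/negP => pS; have := outE _ pS (introN idP (fun h => H (ex_intro _ p h))).
  move=> /= E; have := psiF p; rewrite E -(outE _ wS wT) wF //.
Qed.

End FacetRemoval.

(** * Balls in the non-exceptional case *)

Section Ball.
Local Open Scope classical_set_scope.
Context {R : realType} {d : Order.disp_t} {P : finPOrderType d} {n : nat}.
Context (n_gt0 : (0 < n)%N).
Implicit Types (phi psi : {ffun P -> 'I_n}) (J : set {ffun P -> 'I_n}).

Let bottom : {ffun P -> 'I_n} := [ffun => Ordinal n_gt0].

Lemma poset_ideal_bottom J : poset_ideal J -> J !=set0 -> J bottom.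
Proof.
move=> [_ Jdown] [phi Jphi]; apply: Jdown Jphi => p; last by rewrite ffunE leEord.
by move=> q _; rewrite !ffunE.
Qed.

Lemma facet_complex_bottom :
  pl_iso (R := R) (facet_complex [set bottom])
    [set: {set 'I_#|~: graph bottom|%SET}].
Proof.
apply: (pl_iso_relabel (~: graph bottom)%SET).
- move=> F G FG [psi Jpsi psiG]; exists psi => // p.
  by apply: contra (psiG p); apply: (fintype.subsetP FG).
- move=> F [_ -> bF]; apply/fintype.subsetP => -[p i] vF; rewrite !inE /=.
  by apply: contraTneq vF => ->.
- move=> G; split=> // _; exists bottom => // p.
  by apply/imsetP => -[i _ E]; have := enum_valP i; rewrite -E !inE eqxx.
Qed.

Lemma facet_complex_ball J : poset_ideal J -> J !=set0 ->
  ~ (antichain P /\ J = isotone_maps P 'I_n) ->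
  pl_iso (R := R) (facet_complex J) [set: {set 'I_#|~: graph bottom|%SET}].
Proof.
move: {2}_.+1 (ltnSn #|[set phi | `[< J phi >]]%SET|) => k.
elim: k J => // k IH J Jk Jid J0 Jexc; have Jbot := poset_ideal_bottom J Jid J0.
have [[psi [Jpsi psi0]]|H] := pselect (exists psi, J psi /\ psi <> bottom); last first.
  rewrite (_ : J = [set bottom]); first exact: facet_complex_bottom.
  apply/seteqP; split=> [psi Jpsi|_ ->//]; apply: contrapT => ne.
  by apply: H; exists psi.
have psiT : `[< J psi >] by apply/asboolP.
(* A map of greatest total value is maximal for the pointwise order. *)
case: (@arg_maxnP _ psi (fun phi => `[< J phi >]) (fun phi => \sum_p phi p)%N psiT).
move=> phi /asboolP Jphi phimax.
have phi_max chi : J chi -> pointwise_le phi chi -> chi = phi.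
  move=> Jchi le; apply/ffunP => p; apply/val_inj/eqP; rewrite eqn_leq.
  have lep q : (phi q <= chi q)%N by have := le q; rewrite leEord.
  rewrite lep andbT leqNgt; apply/negP => lt.
  have /= := phimax chi (asboolT Jchi); rewrite leqNgt => /negP; apply.
  rewrite (bigD1 p) //= [X in (_ < X)%N](bigD1 p) //= -addSn leq_add //.
  by apply: leq_sum.
have phi0 : phi <> bottom.
  move=> E; apply: psi0; apply/ffunP => p; rewrite ffunE; apply/val_inj => /=.
  have /= := phimax psi psiT; rewrite E.
  under [leqRHS]eq_bigr do rewrite ffunE; rewrite /= sum_nat_const muln0 leqn0.
  by rewrite sum_nat_eq0 => /forall_inP/(_ p isT)/eqP.
apply: pl_iso_trans (pl_iso_remove_maximal n_gt0 J phi _ _ _ _ _) _ => //.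
apply: IH.
- apply: leq_trans (ltnSE Jk); apply: proper_card; apply/properP; split.
    by apply/fintype.subsetP => chi; rewrite !inE => -[].
  exists phi; rewrite inE; first exact/asboolP.
  by apply/asboolPn => -[_]; apply.
- split=> [chi [/Jid.1]//|chi chi' iso le [Jchi ne]]; split.
    exact: Jid.2 iso le Jchi.
  by move=> E; apply/ne/phi_max => //; rewrite -E.
- by exists bottom; split=> // E; apply: phi0.
(* Without [phi] the ideal is not the set of all isotone maps, so the induction never runs into the
   exceptional case. *)
- move=> [_ E]; have [_ []//] : (J `\ phi) phi by rewrite E; apply: Jid.1.
Qed.

End Ball.

(** * Spheres as joins of simplex boundaries *)

Section Sphere.
Local Open Scope classical_set_scope.
Context {R : realType} {P : finType} {n : nat} (p0 : P) (last : 'I_n).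
Implicit Types (Q : {set P}) (F : {set P * 'I_n}) (p q : P).

Definition fiber p : {set P * 'I_n} := [set v : P * 'I_n | v.1 == p]%SET.

(* The join of the simplex boundaries on the fibers outside [Q] with the one
   obtained by welding the fibers over [Q] together, at the cost of the last
   vertex of each of them but the fiber of [p0]. *)
Definition welded Q : {set P * 'I_n} :=
  [set v : P * 'I_n | (v.1 \in Q) && ((v.1 == p0) || (v.2 != last))]%SET.
Definition partial_weld Q : set {set P * 'I_n} :=
  [set F | [/\ ~~ (welded Q \subset F),
    forall p, p \in Q -> p != p0 -> (p, last) \notin F &
    forall p, p \notin Q -> ~~ (fiber p \subset F)]].

Lemma partial_weld_step Q p : p0 \in Q -> p \notin Q ->
  pl_iso (R := R) (partial_weld Q) (partial_weld (p |: Q)%SET).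
Proof.
move=> p0Q pQ; have pp0 : p != p0 by apply: contraNneq pQ => ->.
(* In the stellar weld, [welded Q] is the subdivided face, [(p, last)] the vertex that disappears
   and [C] the rest of the fiber of [p]. *)
pose C := [set v : P * 'I_n | (v.1 == p) && (v.2 != last)]%SET.
pose L := [set F : {set P * 'I_n} |
  (forall q, q \in Q -> q != p0 -> (q, last) \notin F) /\
  (forall q, q \notin (p |: Q)%SET -> ~~ (fiber q \subset F))].
have CE : ((p, last) |: C = fiber p)%SET.
  by apply/setP => -[q i]; rewrite !inE xpair_eqE; case: (q == p); case: (i == last).
have weldE : (welded Q :|: C = welded (p |: Q))%SET.
  apply/setP => -[q i]; rewrite !inE /=.
  case: (eqVneq q p) => [->|_] /=; last by rewrite orbF.
  by rewrite (negPf pQ) (negPf pp0).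
have -> : partial_weld Q = [set F : {set P * 'I_n} | [/\ ~~ (welded Q \subset F),
    ~~ ((p, last) |: C \subset F)%SET & L F]].
  rewrite CE; apply/seteqP; split=> F [H1 H2 H3].
    split=> //; first exact: H3.
    by split=> // q; rewrite !inE negb_or => /andP[_ qQ]; apply: H3.
  split=> // [|q qQ]; first by case: H3.
  have [->//|qp] := eqVneq q p; apply: H3.2.
  by rewrite !inE negb_or qp.
have -> : partial_weld (p |: Q)%SET = [set F : {set P * 'I_n} | [/\ (p, last) \notin F,
    ~~ (welded Q :|: C \subset F)%SET & L F]].
  rewrite weldE; apply/seteqP; split=> F [H1 H2 H3]; split=> //.
  - by apply: H2; rewrite ?inE ?eqxx.
  - by split=> // q qQ; apply: H2; rewrite inE qQ orbT.
  - by move=> q; rewrite !inE => /predU1P[->|qQ] // ?; apply: H3.1.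
  - exact: H3.2.
apply: (pl_iso_stellar_weld (welded Q) C (p, last) (p0, last)).
- by rewrite inE p0Q eqxx.
- by rewrite inE (negPf pQ).
- by rewrite inE !eqxx.
- by move=> -[q i]; rewrite !inE /= => /andP[/eqP -> _]; rewrite (negPf pQ).
- move=> F G FG [G1 G2]; split=> [q qQ qp|q qQ].
    by apply: contra (G1 q qQ qp); apply: (fintype.subsetP FG).
  by apply: contra (G2 q qQ) => /fintype.subset_trans; apply.
move=> F G FG [F1 F2].
have memE v : v \notin ((p, last) |: (welded Q :|: C))%SET -> (v \in F) = (v \in G).
  move=> vZ; have := congr1 (fun A : {set P * 'I_n} => v \in A) FG.
  by rewrite !finset.in_setD vZ.
split=> [q qQ qp|q qQ].
  rewrite -memE ?F1 // !inE /= eqxx (negPf qp) !andbF !orbF xpair_eqE eqxx andbT.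
  by apply: contraNneq pQ => <-.
apply: contra (F2 q qQ) => /fintype.subsetP qG; apply/fintype.subsetP => -[s i] sq.
move: (sq); rewrite inE /= => /eqP sE; rewrite memE ?qG //.
move: qQ; rewrite sE !inE /= negb_or => /andP[qp qQ].
by rewrite xpair_eqE (negPf qp) (negPf qQ).
Qed.

(** The welds drop one vertex for each element of [P] but [p0]. The extra unit matches [pl_sphere],
    whose model of index [k] has [k.+1] vertices. *)
Lemma card_welded : #|welded finset.setT| + #|P| = (#|{: P * 'I_n}|).+1.
Proof.
have -> : (welded finset.setT = ~: [set (p, last) | p in [set~ p0]])%SET.
  apply/setP => -[p i]; rewrite !inE /=; apply/idP/idP.
    move=> H; apply/imsetP => -[q]; rewrite !inE => qp0 [pq il]; move: H.
    by rewrite pq il eqxx (negPf qp0).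
  apply: contraNT; rewrite negb_or negbK => /andP[pp0 /eqP ->].
  by apply/imsetP; exists p; rewrite ?inE.
have cP : 0 < #|P| by apply/card_gt0P; exists p0.
rewrite -(prednK cP) addnS; congr _.+1.
rewrite -(cardsC1 p0) -(card_imset (mem [set~ p0]%SET) (f := fun p => (p, last))).
  by rewrite addnC cardsC.
by move=> p q [].
Qed.

Lemma partial_weld_sphere Q : p0 \in Q ->
  pl_iso (R := R) (partial_weld Q)
    [set F : {set 'I_#|welded finset.setT|} | F != finset.setT].
Proof.
move: {2}_.+1 (ltnSn #|~: Q|%SET) => k; elim: k Q => // k IH Q Qk p0Q.
have [QT|] := eqVneq Q finset.setT; last first.
  rewrite -finset.subTset => /fintype.subsetPn[p _ pQ].
  apply: pl_iso_trans (partial_weld_step Q p p0Q pQ) _; apply: IH.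
    apply: leq_trans (ltnSE Qk); apply: proper_card.
    rewrite properC; apply/properP; split; first exact: finset.subsetUr.
    by exists p; rewrite ?inE ?eqxx.
  by rewrite inE p0Q orbT.
(* After all the welds, only the boundary of the simplex on [welded finset.setT] is left. *)
rewrite QT; apply: pl_iso_relabel.
- move=> F G FG [H1 H2 H3]; split=> [|p pT pp0|p]; last by rewrite inE.
    by apply: contra H1 => /fintype.subset_trans; apply.
  by apply: contra (H2 p pT pp0); apply: (fintype.subsetP FG).
- move=> F [_ H _]; apply/fintype.subsetP => -[p i]; apply: contraTT.
  by rewrite !inE negb_or negbK => /andP[pp0 /eqP /= ->]; apply: H; rewrite ?inE.
- move=> G; split=> [G1|[H1 _ _]]; last first.
    apply: contraNneq H1 => ->; apply/fintype.subsetP => v vW.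
    by apply/imsetP; exists (enum_rank_in vW v); rewrite ?enum_rankK_in.
  split=> [|p _ pp0|p]; last by rewrite inE.
    apply: contraNN G1 => /fintype.subsetP W; apply/eqP/setP => i; rewrite inE.
    by have /imsetP[j jG /enum_val_inj ->] := W _ (enum_valP i).
  apply/imsetP => -[i _ E]; have := enum_valP i.
  by rewrite -E !inE /= (negPf pp0) eqxx.
Qed.

End Sphere.

(** * The exceptional case of an antichain *)

Section Antichain.
Local Open Scope classical_set_scope.
Context {d : Order.disp_t} {P : finPOrderType d} {n : nat}.
Context (n_gt0 : (0 < n)%N) (antiP : antichain P).

Lemma antichain_isotone (phi : {ffun P -> 'I_n}) : isotone_maps P 'I_n phi.
Proof. by move=> p q /antiP ->. Qed.

Lemma chain_in_antichain (c : {ffun 'I_n -> P}) : isotone_maps 'I_n P c ->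
  exists p, c = [ffun => p].
Proof.
move=> ciso; exists (c (Ordinal n_gt0)); apply/ffunP => i; rewrite ffunE.
by apply/esym/antiP/ciso; rewrite leEord.
Qed.

Lemma fiberE (p : P) :
  fiber (n := n) p = [set (p, i) | i in [set: 'I_n]%SET]%SET.
Proof.
apply/setP => -[q i]; rewrite inE /=; apply/eqP/imsetP => [->|[j _ []//]].
by exists i; rewrite ?inE.
Qed.

Lemma card_fiber (p : P) : #|fiber (n := n) p| = n.
Proof. by rewrite fiberE card_imset ?cardsT ?card_ord // => i j []. Qed.

(** A set missing a vertex of every fiber misses the graph of the map choosing these vertices, and
    on an antichain every map is isotone. *)
Lemma fiber_transversal (F : {set P * 'I_n}) :
  (forall phi, isotone_maps P 'I_n phi -> exists2 v, v \in graph phi & v \in F) <->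
  exists p, fiber p \subset F.
Proof.
split=> [H|[p /fintype.subsetP pF] phi _]; last first.
  by exists (p, phi p); [rewrite inE | apply: pF; rewrite inE].
apply: contrapT => /forallNP no.
have /choice[h hF] : forall p, exists i, (p, i) \notin F.
  move=> p; have /negP/fintype.subsetPn[[q i]] := no p.
  by rewrite inE => /eqP /= ->; exists i.
have [[p i]] := H [ffun p => h p] (antichain_isotone _).
by rewrite inE ffunE => /eqP /= ->; rewrite (negPf (hF p)).
Qed.

(** The complex is the join of the boundaries of the simplices on the fibers, which is the initial
    stage of the welding. *)
Lemma facet_complex_antichain (p0 : P) (last : 'I_n) :
  facet_complex (isotone_maps P 'I_n) = partial_weld p0 last [set p0]%SET.
Proof.
have -> : facet_complex (isotone_maps P 'I_n) =
    [set F : {set P * 'I_n} | forall p, ~~ (fiber p \subset F)].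
  apply/seteqP; split=> F.
    move=> [phi _ phiF] p; apply/fintype.subsetPn; exists (p, phi p) => //.
    by rewrite inE.
  move=> H; have /choice[h hF] : forall p, exists i, (p, i) \notin F.
    move=> p; have /fintype.subsetPn[[q i]] := H p.
    by rewrite inE => /eqP /= ->; exists i.
  exists [ffun p => h p]; first exact: antichain_isotone.
  by move=> p; rewrite ffunE.
have weldE : welded p0 last [set p0]%SET = fiber p0.
  by apply/setP => -[p i]; rewrite !inE /=; case: (p == p0).
apply/seteqP; split=> F; rewrite /partial_weld /= weldE.
  by move=> H; split=> // p; rewrite inE => ->.
move=> [H1 _ H3] p; have [->//|pp0] := eqVneq p p0.
by apply: H3; rewrite inE.
Qed.

Context (K : fieldType).

Definition fiber_monomials : seq 'X_{1..#|{: P * 'I_n}|} :=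
  [seq set_mnm (fiber p) | p <- enum P].

Lemma mem_fiber_ideal (f : polyring K (P * 'I_n)%type) :
  ideal_gen [set` [seq ('X_[m])%R : polyring K (P * 'I_n)%type |
    m <- fiber_monomials]] f <->
  forall q, q \in msupp f -> exists p, fiber p \subset mnm_set q.
Proof.
have -> : [set` [seq ('X_[m])%R : polyring K (P * 'I_n)%type |
      m <- fiber_monomials]] =
    [set ('X_[m])%R | m in [set` fiber_monomials]].
  apply/seteqP; split=> g /=; first by case/mapP => m mF ->; exists m.
  by case=> m mF <-; apply/mapP; exists m.
rewrite mem_monomial_ideal; split=> H q /H.
  by case=> _ /mapP[p _ ->]; rewrite set_mnm_le; exists p.
case=> p pq; exists (set_mnm (fiber p)); rewrite ?set_mnm_le //.
by apply: map_f; rewrite mem_enum.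
Qed.

Lemma mem_antichain_dual (f : polyring K (P * 'I_n)%type) :
  alexander_dual (coletterplace_ideal K (isotone_maps P 'I_n)) f <->
  forall q, q \in msupp f -> exists p, fiber p \subset mnm_set q.
Proof.
rewrite coletterplace_idealE mem_alexander_dual; split=> H q qf.
  apply/fiber_transversal => phi phiiso; apply: (H q qf); exists phi => //.
by move=> _ [phi phiiso <-]; apply: (fiber_transversal _).2 phiiso; exact: H.
Qed.

Lemma antichain_dual : alexander_dual (coletterplace_ideal K (isotone_maps P 'I_n)) =
  ideal_gen [set` [seq ('X_[m])%R : polyring K (P * 'I_n)%type |
    m <- fiber_monomials]].
Proof.
by apply/seteqP; split=> f; rewrite /= ?mem_antichain_dual ?mem_fiber_ideal.
Qed.

Lemma antichain_letterplace : letterplace_ideal K P n =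
  ideal_gen [set` [seq ('X_[m])%R : polyring K (P * 'I_n)%type |
    m <- fiber_monomials]].
Proof.
rewrite /letterplace_ideal; congr ideal_gen.
have chainE (p : P) : (\prod_(i < n) var K (p, i) = 'X_[set_mnm (fiber p)])%R.
  rewrite -prod_var fiberE big_imset /=; last by move=> i j _ _ [].
  by apply: eq_bigl => i; rewrite inE.
apply/seteqP; split=> f.
  move=> [c /chain_in_antichain[p ->] ->]; apply/mapP.
  exists (set_mnm (fiber p)); first by apply: map_f; rewrite mem_enum.
  by rewrite -chainE; apply: eq_bigr => i _; rewrite ffunE.
move=> /mapP[_ /mapP[p _ ->] ->]; exists [ffun => p].
  by move=> i j _; rewrite !ffunE.
by rewrite -chainE; apply: eq_bigr => i _; rewrite ffunE.
Qed.

Lemma fiber_complete_intersection : monomial_complete_intersection #|P| n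
  (ideal_gen [set` [seq ('X_[m])%R : polyring K (P * 'I_n)%type |
    m <- fiber_monomials]]).
Proof.
exists fiber_monomials; split=> //.
- by rewrite size_map -cardE.
- by move=> _ /mapP[p _ ->]; rewrite mdeg_set_mnm card_fiber.
have fiberI (p q : P) : fiber (n := n) p = fiber q -> p = q.
  move=> E; have : (p, Ordinal n_gt0) \in fiber q by rewrite -E inE.
  by rewrite inE => /eqP.
rewrite (_ : [seq _ | m <- _] = [seq ('X_[set_mnm F])%R |
  F <- [seq fiber p | p <- enum P]]); last by rewrite -!map_comp.
apply: disjoint_monomials_regular.
- by rewrite map_inj_uniq ?enum_uniq.
- move=> _ _ /mapP[p _ ->] /mapP[q _ ->] pq; apply/setP => -[s i].
  rewrite !inE /=; apply/negP => /andP[/eqP sp /eqP sq]; case/negP: pq.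
  by rewrite -sp -sq.
- by move=> _ /mapP[p _ ->]; rewrite -card_gt0 card_fiber.
Qed.

End Antichain.

(** This serves the case of an empty [P], where both complexes have no face but the empty one. *)
Lemma empty_realization {R : realType} {V : finType} (D : set {set V}) :
  (forall F, D F -> F = finset.set0) ->
  forall x, ~ realization (R := R) D x.
Proof.
move=> D0 x [_ x1 /D0 x0].
have : (\sum_v x v = 0)%R.
  apply: big1 => v _; apply/eqP; move/setP/(_ v): x0.
  by rewrite !inE => /negbFE.
by rewrite x1 => /eqP; rewrite oner_eq0.
Qed.

Local Open Scope classical_set_scope.

Theorem theorem5p1 (R : realType) (K : fieldType) (d : Order.disp_t)
    (P : finPOrderType d) (n : nat) (n_gt0 : (0 < n)%N)
    (J : set {ffun P -> 'I_n}) (J_ideal : poset_ideal J)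
    (J_neq0 : J !=set0) :
  (~ (antichain P /\ J = isotone_maps P 'I_n) ->
     pl_ball_of_codim R #|P| (dual_complex K J)) /\
  (antichain P /\ J = isotone_maps P 'I_n ->
     [/\ pl_sphere_of_codim R #|P| (dual_complex K J),
         alexander_dual (coletterplace_ideal K J) = letterplace_ideal K P n &
         monomial_complete_intersection #|P| n
           (alexander_dual (coletterplace_ideal K J))]).
Proof.
rewrite dual_complexE; split=> [Jexc|[antiP ->]].
  (* The index is the number of vertices off the graph of the least map, and the graph accounts for
     the other [#|P|]. *)
  eexists; last exact/pl_iso_homeomorphic/(facet_complex_ball n_gt0).
  by rewrite addnC -(card_graph [ffun => Ordinal n_gt0]) cardsC.
split; last first.
- by rewrite antichain_dual //; apply: fiber_complete_intersection.
- by rewrite antichain_dual // antichain_letterplace.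
(* If [P] is empty there is no [p0]; the sphere then has dimension -1 and both realizations are
   empty. *)
have [p0 _|P0] := pickP {: P}; last first.
  have cP : #|P| = 0 by apply: eq_card0.
  exists 0; first by rewrite cP card_prod cP.
  have empty1 F : facet_complex (isotone_maps P 'I_n) F -> F = finset.set0.
    by move=> _; apply/setP => -[p]; have := P0 p.
  have empty2 (F : {set 'I_1}) : F != finset.setT -> F = finset.set0.
    rewrite -finset.subTset => /fintype.subsetPn[i _ iF]; apply/setP => j.
    by rewrite (ord1 j) -(ord1 i) (negPf iF) inE.
  apply/pl_iso_homeomorphic/(pl_isoW _ _ (fun=> [ffun => 0%R]) (fun=> [ffun => 0%R])).
  - apply: (pl_map_realization _ _ (fun F x => [ffun => 0%R])) => //.
      move=> F G _ _; exists [ffun => Ordinal n_gt0]; first exact: antichain_isotone.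
      by move=> p; have := P0 p.
    move=> F w; apply: (pl_fun_ext (fun=> 0%R)) => [x|]; first by rewrite ffunE.
    exact: pl_const.
  - by move=> x /(empty_realization _ empty1).
  - by move=> x /(empty_realization _ empty2).
have last_lt : (n.-1 < n)%N by rewrite prednK.
rewrite (facet_complex_antichain antiP p0 (Ordinal last_lt)).
have := card_welded p0 (Ordinal last_lt).
have := partial_weld_sphere (R := R) p0 (Ordinal last_lt) _ (finset.set11 p0).
(* The value 0 is impossible because [#|P|] is at most [#|P| * n]. *)
set c := #|welded _ _ _|; case: c => [|k] iso.
  rewrite add0n => cP; have := leq_pmulr #|P| n_gt0.
  by rewrite -{1}(card_ord n) -card_prod cP ltnn.
rewrite addSn => -[kP]; exists k => //.
exact: pl_iso_homeomorphic iso.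
Qed.
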